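(* Let $\mathcal{X},\mathcal{Y}$ be finite sets, $\mathcal{B}$ a finite-dimensional Hilbert space, and $(x,y)\mapsto\rho_{xy}$ a two-sender classical-quantum multiple access channel with density matrices $\rho_{xy}$ on $\mathcal{B}$. Let $p_X,p_Y$ be distributions and $\rho^{XYB}=\sum_{x,y}p_X(x)p_Y(y)|x,y\rangle\langle x,y|\otimes\rho_{xy}$. For every rate pair $(R_1,R_2)$ with \[ R_1<I(X:B|Y)_\rho,\quad R_2<I(Y:B|X)_\rho,\quad R_1+R_2<I(XY:B)_\rho, \] and every $\eta>0$, there exist $\delta,\epsilon\in(0,1/64)$ and a positive integer $n$ such that the following scheme over $n$ channel uses with message sets $[M_1]$, $[M_2]$, $M_i=\lfloor2^{nR_i}\rfloor$, has expected (over the random codebook) average error probability of decoding the pair $(m_1,m_2)$ at most $\eta$. Encoding: sender 1 chooses codewords $x^n(m_1)$ independently i.i.d. from $p_X^{\otimes n}$, sender 2 chooses $y^n(m_2)$ independently i.i.d. from $p_Y^{\otimes n}$; sending $(m_1,m_2)$ produces $\rho_{x^n(m_1)y^n(m_2)}$. Decoding projectors: for $x^ny^n\in T^{(XY)^n}_\delta$, let $A'$ be the support of $\Pi^{\rho_{x^ny^n}}_\delta$ and $B'$ the support of $\Pi^{\rho_{y^n}}_{6\delta}$, let $A$ be the span of the eigenvectors of $\Pi_{A'}\Pi_{B'}\Pi_{A'}$ with eigenvalue at least $1-\sqrt{\epsilon}$, let $B:=\operatorname{span}\{\Pi_{B'}v:v\in A\}$ and $\tilde\Pi_{x^ny^n}:=\Pi_B$;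 for $x^ny^n\notin T^{(XY)^n}_\delta$ let $\tilde\Pi_{x^ny^n}:=0$. Decoder: looping over pairs $(m_1,m_2)$ in lexicographic order ($m_1$ outer, $m_2$ inner), perform on the current post-measurement state the projective measurement $\{\tilde\Pi_{x^n(m_1)y^n(m_2)},I-\tilde\Pi_{x^n(m_1)y^n(m_2)}\}$; at the first success output $(m_1,m_2)$; if none succeeds, abort.
   Context: Logarithms base 2; conditional mutual informations are those of $\rho^{XYB}$. $\rho_y:=\sum_xp_X(x)\rho_{xy}$; for sequences, $\rho_{x^ny^n}:=\bigotimes_i\rho_{x_iy_i}$ and $\rho_{y^n}:=\bigotimes_i\rho_{y_i}$. Typical set $T^{W^n}_\delta:=\{w^n:\forall w,\ |N(w|w^n)/n-p_W(w)|\le\delta p_W(w)\}$ (here for $W=(X,Y)$ with distribution $p_Xp_Y$). For a density matrix $\sigma=\sum_sq(s)|s\rangle\langle s|$ in a fixed eigenbasis, $\Pi^{\sigma^N}_\delta$ projects onto the span of $|s^N\rangle$ with $|N(s|s^N)/N-q(s)|\le\delta q(s)$ for all $s$. For an ensemble $\{\sigma_w\}$ and sequence $w^n$, the conditionally typical projector of $\sigma_{w^n}=\bigotimes_i\sigma_{w_i}$ is $\Pi^{\sigma_{w^n}}_\delta:=\bigotimes_w\Pi^{\sigma_w^{\otimes N(w|w^n)}}_\delta$, the factor for $w$ acting on positions with $w_i=w$ (applied here with $w=(x,y)$ and $w=y$). $\Pi_{S}$ denotes the orthogonal projector onto subspace $S$. *)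

(* Defs.v *)
From HB Require Import structures.
From mathcomp Require Import all_boot all_order all_algebra.
From mathcomp Require Import reals exp.
From mathcomp Require Import complex.
Set Implicit Arguments. Unset Strict Implicit. Unset Printing Implicit Defensive.
Import Order.TTheory GRing.Theory Num.Theory.
Local Open Scope ring_scope.

Section QDefs.
Variable R : realType.
Local Notation C := (R[i]).

Definition toC (r : R) : C := Complex r 0.
Definition reC (z : C) : R := complex.Re z.

Definition mxH m n (A : 'M[C]_(m, n)) : 'M[C]_(n, m) := (map_mx (@conjc R) A)^T.

Definition psdmx n (A : 'M[C]_n) : Prop :=
  A = mxH A /\ forall v : 'cV[C]_n, 0 <= (mxH v *m A *m v) 0 0.
Definition density n (A : 'M[C]_n) : Prop := psdmx A /\ \tr A = 1.

Definition distr (T : finType) (p : T -> R) : Prop :=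
  (forall t, 0 <= p t) /\ \sum_t p t = 1.

Definition eigdec n (A U : 'M[C]_n) (q : 'I_n -> R) : Prop :=
  U *m mxH U = 1%:M /\ mxH U *m U = 1%:M /\
  A = U *m diag_mx (\row_s toC (q s)) *m mxH U.

Definition eigvals n (A : 'M[C]_n) : seq C :=
  sval (closed_field_poly_normal (char_poly A)).

Definition log2 (r : R) : R := ln r / ln 2.

(* von Neumann entropy  S(A) = - sum_lambda lambda log2 lambda  (0 log 0 = 0) *)
Definition entropy n (A : 'M[C]_n) : R :=
  \sum_(l <- eigvals A) - (reC l * log2 (reC l)).

(* A system with orthonormal basis indexed by a finType K is C^#|K|;
   basis vector k is at position enum_rank k. *)
Definition fmx (K : finType) (f : K -> K -> C) : 'M[C]_#|K| :=
  \matrix_(i, j) f (enum_val i) (enum_val j).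

(* partial trace: the state lives on T ~= K x D via t |-> (keep t, drop t);
   trace out D, keep K. *)
Definition ptrace (T K D : finType) (keep : T -> K) (drop : T -> D)
  (rho : T -> T -> C) : 'M[C]_#|K| :=
  fmx (fun k k' => \sum_(t : T) \sum_(t' : T)
        if (keep t == k) && (keep t' == k') && (drop t == drop t')
        then rho t t' else 0).

Section CQ.
Variables (X Y : finType) (d : nat) (rho : X -> Y -> 'M[C]_d)
  (pX : X -> R) (pY : Y -> R).

Definition XYB := ((X * Y) * 'I_d)%type.

(* rho^{XYB} = sum_{x,y} pX(x) pY(y) |x,y><x,y| (x) rho_xy, entrywise *)
Definition rhoXYB (t t' : XYB) : C :=
  if t.1 == t'.1 then toC (pX t.1.1 * pY t.1.2) * rho t.1.1 t.1.2 t.2 t'.2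
  else 0.

Definition S_XYB : R := entropy (fmx rhoXYB).
Definition S_XY : R := entropy (ptrace (fun t : XYB => t.1) (fun t => t.2) rhoXYB).
Definition S_YB : R :=
  entropy (ptrace (fun t : XYB => (t.1.2, t.2)) (fun t => t.1.1) rhoXYB).
Definition S_XB : R :=
  entropy (ptrace (fun t : XYB => (t.1.1, t.2)) (fun t => t.1.2) rhoXYB).
Definition S_X : R :=
  entropy (ptrace (fun t : XYB => t.1.1) (fun t => (t.1.2, t.2)) rhoXYB).
Definition S_Y : R :=
  entropy (ptrace (fun t : XYB => t.1.2) (fun t => (t.1.1, t.2)) rhoXYB).
Definition S_B : R :=
  entropy (ptrace (fun t : XYB => t.2) (fun t => t.1) rhoXYB).

Definition I_X_B_given_Y : R := S_XY + S_YB - S_XYB - S_Y.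
Definition I_Y_B_given_X : R := S_XY + S_XB - S_XYB - S_X.
Definition I_XY_B : R := S_XY + S_B - S_XYB.

Definition rhoY (y : Y) : 'M[C]_d := \sum_x toC (pX x) *: rho x y.
End CQ.

(* (C^d)^{(x) n} has orthonormal basis indexed by sequences j^n in 'I_d^n *)
Definition nsys (n d : nat) := #|{ffun 'I_n -> 'I_d}|.

Definition tensn (n d : nat) (F : 'I_n -> 'M[C]_d) : 'M[C]_(nsys n d) :=
  fmx (fun (j k : {ffun 'I_n -> 'I_d}) => \prod_i F i (j i) (k i)).

Definition Ncount (T : finType) (n : nat) (a : T) (s : 'I_n -> T) : nat :=
  #|[set i | s i == a]|.

Definition typical (W : finType) (n : nat) (p : W -> R) (delta : R)
  (w : {ffun 'I_n -> W}) : bool :=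
  [forall a, `| (Ncount a w)%:R / n%:R - p a | <= delta * p a].

(* Conditionally typical projector Pi^{sigma_{w^n}}_delta of sigma_{w^n} =
   (x)_i sigma_{w_i}, where sigma_w = sum_s q_w(s) |s>_w <s|_w with
   |s>_w = column s of the unitary U_w.  It is the tensor product over w of
   Pi^{sigma_w^{(x) N(w|w^n)}}_delta acting on the positions {i | w_i = w}
   (a factor with N(w|w^n) = 0 acts on the empty set of positions, i.e. is
   the scalar 1).  Hence it is the projector onto the span of the orthonormal
   product vectors (x)_i |s_i>_{w_i} such that for every w occurring in w^n
   the subsequence (s_i)_{w_i = w} is delta-typical for q_w. *)
Definition condtyp_proj (W : finType) (n d : nat) (U : W -> 'M[C]_d)
  (q : W -> 'I_d -> R) (delta : R) (w : {ffun 'I_n -> W}) : 'M[C]_(nsys n d) :=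
  \sum_(s : {ffun 'I_n -> 'I_d} |
        [forall a, (0 < Ncount a w)%N ==>
           [forall b, `| (#|[set i | (w i == a) && (s i == b)]|)%:R
                          / (Ncount a w)%:R - q a b | <= delta * q a b]])
     (let v : 'cV[C]_(nsys n d) :=
          \col_(j < #|{ffun 'I_n -> 'I_d}|) (\prod_i U (w i) ((enum_val j : {ffun 'I_n -> 'I_d}) i) (s i)) in v *m mxH v).

(* Subspaces of C^N are represented as row spaces (mxalgebra, %MS); a ket
   |v> (a column vector) is represented by the row v^T. *)
(* orthogonal projector Pi_S onto S :  K (K^* K)^{-1} K^*  where the columns of
   K = (row_base S)^T form a basis of S. *)
Definition orthproj N m (S : 'M[C]_(m, N)) : 'M[C]_N :=
  let K := (row_base S)^T in K *m invmx (mxH K *m K) *m mxH K.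

Definition support N (P : 'M[C]_N) : 'M[C]_N := P^T.

Definition eigspan_ge N (M : 'M[C]_N) (t : R) : 'M[C]_N :=
  (\sum_(a <- eigvals M | (toC t <= a)%R) eigenspace M^T a)%MS.

Section Decoder.
Variables (X Y : finType) (d : nat) (pX : X -> R) (pY : Y -> R)
  (U : X -> Y -> 'M[C]_d) (lam : X -> Y -> 'I_d -> R)
  (V : Y -> 'M[C]_d) (mu : Y -> 'I_d -> R) (n : nat) (delta eps : R).

Definition pXY (w : X * Y) : R := pX w.1 * pY w.2.

Definition dec_proj (xn : {ffun 'I_n -> X}) (yn : {ffun 'I_n -> Y})
  : 'M[C]_(nsys n d) :=
  let w := [ffun i => (xn i, yn i)] in
  if typical pXY delta w then
    let PA' := orthproj (support
                 (condtyp_proj (fun w : X * Y => U w.1 w.2)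
                               (fun w : X * Y => lam w.1 w.2) delta w)) in
    let PB' := orthproj (support (condtyp_proj V mu (6 * delta) yn)) in
    let A := eigspan_ge (PA' *m PB' *m PA') (1 - Num.sqrt eps) in
    let B := A *m PB'^T in
    orthproj B
  else 0.
End Decoder.

Section Scheme.
Variables (X Y : finType) (d : nat) (rho : X -> Y -> 'M[C]_d)
  (pX : X -> R) (pY : Y -> R)
  (U : X -> Y -> 'M[C]_d) (lam : X -> Y -> 'I_d -> R)
  (V : Y -> 'M[C]_d) (mu : Y -> 'I_d -> R)
  (n M1 M2 : nat) (delta eps : R).

Definition codebook1 := {ffun 'I_M1 -> {ffun 'I_n -> X}}.
Definition codebook2 := {ffun 'I_M2 -> {ffun 'I_n -> Y}}.

Definition prob_cb1 (c1 : codebook1) : R := \prod_m \prod_i pX (c1 m i).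
Definition prob_cb2 (c2 : codebook2) : R := \prod_m \prod_i pY (c2 m i).

Definition lexpairs : seq ('I_M1 * 'I_M2) :=
  [seq (a, b) | a <- enum 'I_M1, b <- enum 'I_M2].

(* error probability when (m1, m2) is sent: 1 - Pr[first success at (m1,m2)].
   After failures at p_1, ..., p_{k-1} and success at p_k = (m1,m2), the
   (unnormalized) post-measurement operator is
   W = P_{p_k} Q_{p_{k-1}} ... Q_{p_1},  Q = I - P. *)
Definition err_msg (c1 : codebook1) (c2 : codebook2) (m1 : 'I_M1) (m2 : 'I_M2) : R :=
  let P p := dec_proj pX pY U lam V mu delta eps (c1 p.1) (c2 p.2) in
  let before := take (index (m1, m2) lexpairs) lexpairs in
  let Qs := foldl (fun acc p => (1%:M - P p) *m acc) 1%:M before in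
  let W := P (m1, m2) *m Qs in
  let sigma := tensn (fun i => rho (c1 m1 i) (c2 m2 i)) in
  1 - reC (\tr (W *m sigma *m mxH W)).

Definition avg_err (c1 : codebook1) (c2 : codebook2) : R :=
  (M1 * M2)%:R^-1 * \sum_m1 \sum_m2 err_msg c1 c2 m1 m2.

Definition expected_avg_err : R :=
  \sum_(c1 : codebook1) \sum_(c2 : codebook2)
     prob_cb1 c1 * prob_cb2 c2 * avg_err c1 c2.
End Scheme.

Definition nmsg (n : nat) (r : R) : nat := Num.truncn (2 `^ (n%:R * r)).

End QDefs.

(* Main.v *)
Require Import Defs.
From HB Require Import structures.
From mathcomp Require Import all_boot all_order all_algebra.
From mathcomp Require Import reals exp.
From mathcomp Require Import complex.
From mathcomp Require Import sequences spectral ring lra.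
Set Implicit Arguments. Unset Strict Implicit. Unset Printing Implicit Defensive.
Import Order.TTheory GRing.Theory Num.Theory.
Local Open Scope ring_scope.

(** The received state [rho_{x^n y^n}] is replaced by its compression by the
    typical projectors of [rho_{x^n}] and of [rho^n], and the sequential
    decoder is analysed by Gao's noncommutative union bound
    [|S|^2 - |P_k ... P_1 S|^2 <= 4 \sum_i |(1 - P_i) S|^2].  Averaged over the
    codebook, a pair with wrong second or both components is then accepted with
    probability at most [2^{-n I(Y:B|X)}] resp. [2^{-n I(XY:B)}] (up to
    [2^{O(n delta)}]), by flatness of the compressed state and a trace bound.
    A pair wrong only in its first component is controlled through the decoder
    instead: [Pi_B' Pi_A' Pi_B'] commutes with [Pi_B] and is at least
    [1 - sqrt eps] on [B], whence [Pi_B <= (1 - sqrt eps)^-1 Pi_B' Pi_A' Pi_B'],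
    and averaging [Pi_A' <= 2^{n H(B|XY)} rho_{x^n y^n}] over the wrong [x^n] leaves
    [Pi_B' rho_{y^n} Pi_B' <= 2^{-n H(B|Y)}], for any received state.  A constant
    [eps = 1/100] suffices, since [1 - Pi_B] is bounded by a constant times
    [(1 - Pi_A') + (1 - Pi_B')]. *)

(** * Hilbert-Schmidt geometry *)

(** The obstacle is that each of the three ways of being wrong wants its own smoothing of the
    received state, and the typical projectors of $\rho_{x^n}$, $\rho_{y^n}$ and $\rho^n$ need not
    commute. Two of them can be nested: with that of $\rho^n$ outermost, averaging over $y^n$ meets
    the projector of $\rho_{x^n}$ directly, and averaging over $x^n$ as well lets it be dropped and
    exposes the outer one. The third is moved from the state into the test. The tilted test depends
    on the wrong $x^n$ in a nonlinear way, but the operator dominating it is linear in $\Pi_{A'}$,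
    hence in a state that can be averaged. States enter through a square root $S$ with
    $\sigma=SS^*$, measured in Hilbert-Schmidt norm, so arguments for vectors apply unchanged to
    mixed states. Only losses of order $1/n$ are needed: Chebyshev's inequality handles typicality,
    and exponential decay is weakened to $1/n$. The value $1/100$ is a perfect square below $1/64$,
    which makes the threshold $1-\sqrt\epsilon$ the rational $9/10$. *)

Section HilbertSchmidt.
Variable R : realType.
Local Notation C := R[i].

Lemma reCD (a b : C) : reC (a + b) = reC a + reC b.
Proof. by case: a b => [a1 a2] [b1 b2]. Qed.

Lemma reCN (a : C) : reC (- a) = - reC a.
Proof. by case: a. Qed.

Lemma reC_sum I (s : seq I) (P : pred I) (F : I -> C) :
  reC (\sum_(i <- s | P i) F i) = \sum_(i <- s | P i) reC (F i).
Proof. by apply: (big_morph (@reC R)) => // a b; exact: reCD. Qed.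

Lemma reC_toCM (r : R) (a : C) : reC (toC r * a) = r * reC a.
Proof. by case: a => a b; rewrite /reC /= mul0r subr0. Qed.

Lemma reC_conj (a : C) : reC (conjc a) = reC a.
Proof. by case: a. Qed.

Lemma toCE (r : R) : toC r = real_complex R r. Proof. by []. Qed.

Lemma toC0 : toC (0 : R) = 0. Proof. by []. Qed.
Lemma toC1 : toC (1 : R) = 1. Proof. by []. Qed.
Lemma toCD (a b : R) : toC (a + b) = toC a + toC b.
Proof. by rewrite !toCE rmorphD. Qed.
Lemma toCM (a b : R) : toC (a * b) = toC a * toC b.
Proof. by rewrite !toCE rmorphM. Qed.
Lemma toC_sum I (s : seq I) (P : pred I) (F : I -> R) :
  toC (\sum_(i <- s | P i) F i) = \sum_(i <- s | P i) toC (F i).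
Proof. exact: (big_morph (@toC R) toCD). Qed.
Lemma toC_prod I (s : seq I) (P : pred I) (F : I -> R) :
  toC (\prod_(i <- s | P i) F i) = \prod_(i <- s | P i) toC (F i).
Proof. exact: (big_morph (@toC R) toCM). Qed.
Lemma mxHM m n p (A : 'M[C]_(m, n)) (B : 'M[C]_(n, p)) :
  mxH (A *m B) = mxH B *m mxH A.
Proof. by rewrite /mxH map_mxM trmx_mul. Qed.

Lemma mxHK m n (A : 'M[C]_(m, n)) : mxH (mxH A) = A.
Proof. by apply/matrixP => i j; rewrite !mxE conjcK. Qed.

Lemma mxHD m n (A B : 'M[C]_(m, n)) : mxH (A + B) = mxH A + mxH B.
Proof. by apply/matrixP => i j; rewrite !mxE rmorphD. Qed.

Lemma mxHN m n (A : 'M[C]_(m, n)) : mxH (- A) = - mxH A.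
Proof. by apply/matrixP => i j; rewrite !mxE rmorphN. Qed.

Lemma mxHB m n (A B : 'M[C]_(m, n)) : mxH (A - B) = mxH A - mxH B.
Proof. by rewrite mxHD mxHN. Qed.

Lemma mxHZ m n (r : R) (A : 'M[C]_(m, n)) : mxH (toC r *: A) = toC r *: mxH A.
Proof. by apply/matrixP => i j; rewrite !mxE rmorphM /= oppr0. Qed.

Lemma mxH0 m n : mxH (0 : 'M[C]_(m, n)) = 0.
Proof. by apply/matrixP => i j; rewrite !mxE rmorph0. Qed.

Lemma mxH1 n : mxH (1%:M : 'M[C]_n) = 1%:M.
Proof.
by apply/matrixP => i j; rewrite !mxE eq_sym rmorph_nat.
Qed.

Lemma mxH_diag n (q : 'I_n -> R) :
  mxH (diag_mx (\row_s toC (q s))) = diag_mx (\row_s toC (q s)).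
Proof.
apply/matrixP => i j; rewrite !mxE eq_sym; case: eqP => [->|_] /=.
  by rewrite !mulr1n /= oppr0.
by rewrite !mulr0n /= oppr0.
Qed.

Definition rtr n (A : 'M[C]_n) : R := reC (\tr A).

Lemma rtrD n (A B : 'M[C]_n) : rtr (A + B) = rtr A + rtr B.
Proof. by rewrite /rtr mxtraceD reCD. Qed.
Lemma rtrN n (A : 'M[C]_n) : rtr (- A) = - rtr A.
Proof. by rewrite /rtr raddfN /= reCN. Qed.
Lemma rtrZ n (r : R) (A : 'M[C]_n) : rtr (toC r *: A) = r * rtr A.
Proof. by rewrite /rtr mxtraceZ reC_toCM. Qed.
Lemma rtr_mulC m n (A : 'M[C]_(m, n)) (B : 'M[C]_(n, m)) :
  rtr (A *m B) = rtr (B *m A).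
Proof. by rewrite /rtr mxtrace_mulC. Qed.
Lemma rtrH n (A : 'M[C]_n) : rtr (mxH A) = rtr A.
Proof.
by rewrite /rtr /mxH mxtrace_tr /mxtrace !reC_sum; apply: eq_bigr => i _; rewrite !mxE reC_conj.
Qed.
Lemma rtr_sum n I (s : seq I) (P : pred I) (F : I -> 'M[C]_n) :
  rtr (\sum_(i <- s | P i) F i) = \sum_(i <- s | P i) rtr (F i).
Proof.
apply: (big_morph (@rtr n)); first exact: rtrD.
by rewrite /rtr mxtrace0.
Qed.

(** Taking the real part gives a symmetric real bilinear form, so expansions of [hs] become linear
    arithmetic. Rectangular arguments are allowed in order that a square root of a state can play
    the role of a vector. *)
Definition ip m n (A B : 'M[C]_(m, n)) : R := rtr (mxH A *m B).
Definition hs m n (A : 'M[C]_(m, n)) : R := ip A A.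

Lemma ipC m n (A B : 'M[C]_(m, n)) : ip A B = ip B A.
Proof. by rewrite /ip -rtrH mxHM mxHK. Qed.
Lemma ipDr m n (A B D : 'M[C]_(m, n)) : ip A (B + D) = ip A B + ip A D.
Proof. by rewrite /ip mulmxDr rtrD. Qed.
Lemma ipNr m n (A B : 'M[C]_(m, n)) : ip A (- B) = - ip A B.
Proof. by rewrite /ip mulmxN rtrN. Qed.
Lemma ipBr m n (A B D : 'M[C]_(m, n)) : ip A (B - D) = ip A B - ip A D.
Proof. by rewrite ipDr ipNr. Qed.
Lemma ipZr m n (r : R) (A B : 'M[C]_(m, n)) : ip A (toC r *: B) = r * ip A B.
Proof. by rewrite /ip -scalemxAr rtrZ. Qed.
Lemma ipDl m n (A B D : 'M[C]_(m, n)) : ip (A + B) D = ip A D + ip B D.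
Proof. by rewrite ipC ipDr !(ipC D). Qed.
Lemma ipBl m n (A B D : 'M[C]_(m, n)) : ip (A - B) D = ip A D - ip B D.
Proof. by rewrite ipC ipBr !(ipC D). Qed.
Lemma ip_adj m n p (D : 'M[C]_(m, p)) (A : 'M[C]_(m, n)) (B : 'M[C]_(p, n)) :
  ip A (D *m B) = ip (mxH D *m A) B.
Proof. by rewrite /ip mxHM mxHK !mulmxA. Qed.

Lemma hsE m n (A : 'M[C]_(m, n)) :
  hs A = \sum_j \sum_i (complex.Re (A i j) ^+ 2 + complex.Im (A i j) ^+ 2).
Proof.
rewrite /hs /ip /rtr /mxtrace reC_sum; apply: eq_bigr => j _.
rewrite mxE reC_sum; apply: eq_bigr => i _; rewrite !mxE.
by case: (A i j) => a b; rewrite /reC /=; ring.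
Qed.

Lemma hs_ge0 m n (A : 'M[C]_(m, n)) : 0 <= hs A.
Proof.
rewrite hsE; apply: sumr_ge0 => j _; apply: sumr_ge0 => i _.
by rewrite addr_ge0 ?sqr_ge0.
Qed.

Lemma hs_eq0 m n (A : 'M[C]_(m, n)) : hs A = 0 -> A = 0.
Proof.
rewrite hsE => /eqP; rewrite psumr_eq0; last first.
  by move=> j _; apply: sumr_ge0 => i _; rewrite addr_ge0 ?sqr_ge0.
move=> /allP h; apply/matrixP => i j; rewrite mxE.
have /= := h j (mem_index_enum _); rewrite psumr_eq0; last first.
  by move=> k _; rewrite addr_ge0 ?sqr_ge0.
move=> /allP /(_ i (mem_index_enum _)) /=.
rewrite paddr_eq0 ?sqr_ge0 // !sqrf_eq0 => /andP[a b].
by apply/eqP; rewrite eq_complex a b.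
Qed.

Lemma hsN m n (A : 'M[C]_(m, n)) : hs (- A) = hs A.
Proof. by rewrite /hs ipNr ipC ipNr opprK. Qed.
Lemma hsD m n (A B : 'M[C]_(m, n)) : hs (A + B) = hs A + 2 * ip A B + hs B.
Proof. rewrite /hs !ipDl !ipDr (ipC B A); ring. Qed.
Lemma hsB m n (A B : 'M[C]_(m, n)) : hs (A - B) = hs A - 2 * ip A B + hs B.
Proof. rewrite /hs !ipBl !ipBr (ipC B A); ring. Qed.
Lemma hsD_le m n (A B : 'M[C]_(m, n)) : hs (A + B) <= 2 * hs A + 2 * hs B.
Proof. by have := hs_ge0 (A - B); rewrite hsB hsD; lra. Qed.
Lemma hsZ m n (r : R) (A : 'M[C]_(m, n)) : hs (toC r *: A) = r ^+ 2 * hs A.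
Proof. by rewrite /hs ipZr ipC ipZr; ring. Qed.
(** Young's inequality: expand [hs (r A - B) >= 0] and divide by [r]. The weight is 2 in the union
    bound and [tau] in the passage from the compressed state back to the true one. *)
Lemma ip_le m n (A B : 'M[C]_(m, n)) (r : R) : 0 < r ->
  2 * ip A B <= r * hs A + r^-1 * hs B.
Proof.
move=> r0; have := hs_ge0 (toC r *: A - B).
rewrite hsB hsZ (ipC _ B) ipZr (ipC B) => h.
have := mulr_ge0 (ltW (etrans (invr_gt0 r) r0)) h.
suff -> : r^-1 * (r ^+ 2 * hs A - 2 * (r * ip A B) + hs B) =
  r * hs A - 2 * ip A B + r^-1 * hs B by lra.
by field; rewrite gt_eqF.
Qed.

Definition isproj n (P : 'M[C]_n) := mxH P = P /\ P *m P = P.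

Lemma isproj0 n : isproj (0 : 'M[C]_n).
Proof. by split; rewrite ?mxH0 ?mul0mx. Qed.

Lemma isprojC n (P : 'M[C]_n) : isproj P -> isproj (1%:M - P).
Proof.
move=> [h i]; split; first by rewrite mxHB mxH1 h.
by rewrite mulmxBl mul1mx mulmxBr mulmx1 i subrr subr0.
Qed.

Section Projectors.
Variables (n m : nat) (P : 'M[C]_n).
Hypothesis projP : isproj P.

Lemma proj_ip (A B : 'M[C]_(n, m)) : ip (P *m A) (P *m B) = ip A (P *m B).
Proof. by rewrite ip_adj projP.1 mulmxA projP.2 -[in LHS]projP.1 -ip_adj. Qed.

Lemma hs_proj (A : 'M[C]_(n, m)) : hs (P *m A) = ip A (P *m A).
Proof. exact: proj_ip. Qed.

Lemma hs_projC (A : 'M[C]_(n, m)) : hs ((1%:M - P) *m A) = hs A - hs (P *m A).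
Proof.
rewrite mulmxBl mul1mx hsB -hs_proj; ring.
Qed.

Lemma hs_proj_le (A : 'M[C]_(n, m)) : hs (P *m A) <= hs A.
Proof. by have := hs_ge0 ((1%:M - P) *m A); rewrite hs_projC; lra. Qed.

End Projectors.

Lemma hs_proj_rtr n (P : 'M[C]_n) : isproj P -> hs P = rtr P.
Proof. by move=> [h i]; rewrite /hs /ip h i. Qed.

(** Loewner order, tested on the columns of matrices [S] of any width. *)
Definition lop n (A B : 'M[C]_n) := forall m (S : 'M[C]_(n, m)), ip S (A *m S) <= ip S (B *m S).

Lemma lop_rtr n (A B : 'M[C]_n) : lop A B -> rtr A <= rtr B.
Proof. by move=> /(_ _ 1%:M); rewrite /ip mxH1 !mul1mx !mulmx1. Qed.

Lemma lop_conj n p (A B : 'M[C]_n) (K : 'M[C]_(n, p)) : lop A B ->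
  lop (mxH K *m A *m K) (mxH K *m B *m K).
Proof.
move=> h m S; have := h _ (K *m S).
by rewrite -!mulmxA (ip_adj (mxH K)) [X in _ -> _ <= X](ip_adj (mxH K)) mxHK.
Qed.

Lemma lop_diag n (V : 'M[C]_n) (a b : 'I_n -> R) : (forall i, a i <= b i) ->
  lop (V *m diag_mx (\row_i toC (a i)) *m mxH V) (V *m diag_mx (\row_i toC (b i)) *m mxH V).
Proof.
move=> ab; rewrite -{1 3}[V]mxHK; apply: lop_conj => m S.
rewrite -subr_ge0 -ipBr -mulmxBl; set D := _ - _.
have -> : ip S (D *m S) = \sum_j \sum_i (b i - a i) * (complex.Re (S i j) ^+ 2 + complex.Im (S i j) ^+ 2).
  rewrite /ip /rtr /mxtrace reC_sum; apply: eq_bigr => j _.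
  rewrite mxE reC_sum; apply: eq_bigr => i _.
  rewrite {}/D -raddfB /= mul_diag_mx !mxE.
  by case: (S i j) => x y; rewrite /reC /=; ring.
apply: sumr_ge0 => j _; apply: sumr_ge0 => i _.
by rewrite mulr_ge0 ?subr_ge0 ?addr_ge0 ?sqr_ge0.
Qed.

End HilbertSchmidt.

(** * Orthogonal projectors and spectral decompositions *)

Section Subspaces.
Variable R : realType.
Local Notation C := R[i].

Lemma gram_unit n r (K : 'M[C]_(n, r)) : row_free K^T -> mxH K *m K \in unitmx.
Proof.
move=> fK; rewrite -row_free_unit -kermx_eq0; set Z := kermx _.
have ZG : Z *m (mxH K *m K) = 0 by apply/sub_kermxP.
have h0 : K *m mxH Z = 0.
  by apply: hs_eq0; rewrite /hs /ip mxHM mxHK mulmxA -(mulmxA Z) ZG mul0mx /rtr mxtrace0.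
have : (mxH Z)^T *m K^T = 0 by rewrite -trmx_mul h0 trmx0.
move/eqP; rewrite mulmx_free_eq0 // => /eqP h.
by rewrite -[Z]mxHK -[mxH Z]trmxK h trmx0 mxH0.
Qed.

Section GramProjector.
Variables (n r : nat) (K : 'M[C]_(n, r)) (H : 'M[C]_(r, n)) (Gi : 'M[C]_r).
Hypotheses (KH : mxH K = H) (GiH : mxH Gi = Gi) (GiV : Gi *m (H *m K) = 1%:M).

Lemma gram_projK : K *m Gi *m H *m K = K.
Proof. by rewrite -mulmxA -mulmxA GiV mulmx1. Qed.

Lemma isproj_gram : isproj (K *m Gi *m H).
Proof.
split; first by rewrite mxHM mxHM GiH -{1}KH mxHK KH mulmxA.
by rewrite mulmxA mulmxA gram_projK.
Qed.

End GramProjector.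

Section Orthproj.
Variables (m N : nat) (S : 'M[C]_(m, N)).

Lemma orthproj_gram : exists (K : 'M[C]_(N, \rank S)) Gi,
  [/\ K = (row_base S)^T, mxH Gi = Gi, Gi *m (mxH K *m K) = 1%:M &
   orthproj S = K *m Gi *m mxH K].
Proof.
have fK : row_free ((row_base S)^T)^T by rewrite trmxK row_base_free.
have uG := gram_unit fK; rewrite /orthproj.
set K := (row_base S)^T in uG *; exists K, (invmx (mxH K *m K)).
split=> //; last exact: mulVmx.
have hG : mxH (mxH K *m K) = mxH K *m K by rewrite mxHM mxHK.
by rewrite {1}/mxH map_invmx trmx_inv; exact: congr1 hG.
Qed.

Lemma isproj_orthproj : isproj (orthproj S).
Proof. by have [K [Gi [_ h1 h2 ->]]] := orthproj_gram; exact: isproj_gram. Qed.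

Lemma orthproj_id : orthproj S *m S^T = S^T.
Proof.
have [K [Gi [hK h1 h2 ->]]] := orthproj_gram.
have -> : S^T = K *m (col_base S)^T by rewrite hK -trmx_mul mulmx_base.
by rewrite mulmxA (gram_projK h2).
Qed.

(** Together with [orthproj_id] this pins the range down to the column space of [S^T]: one gives
    each inclusion. Later arguments use only these two facts and never the Gram formula. *)
Lemma orthproj_factor : exists Z, orthproj S = S^T *m Z.
Proof.
have [K [Gi [hK h1 h2 ->]]] := orthproj_gram.
have /submxP[D hD] : (row_base S <= S)%MS by rewrite eq_row_base.
by exists (D^T *m Gi *m mxH K); rewrite !mulmxA -trmx_mul -hD -hK.
Qed.

End Orthproj.

(** The two projectors have the same range. From [P = Q Z] follows [Q P = P], while the adjoint of
    [P Q = Q] reads [Q P = Q]. *)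
Lemma proj_uniq n (P Q Z : 'M[C]_n) : isproj P -> isproj Q -> P *m Q = Q -> P = Q *m Z ->
  P = Q.
Proof.
move=> [hP _] [hQ iQ] PQ PZ.
have QP : Q *m P = P by rewrite PZ mulmxA iQ.
by rewrite -QP -[RHS]hQ -{2}PQ mxHM hP hQ.
Qed.

(** Rebuilding a projector from a basis of its range returns it. Thus the projectors on $A'$ and
    $B'$ inside [dec_proj] are the conditionally typical projectors themselves. *)
Lemma orthproj_support n (P : 'M[C]_n) : isproj P -> orthproj (Defs.support P) = P.
Proof.
move=> pP; have [Z hZ] := orthproj_factor (Defs.support P).
apply: (@proj_uniq _ _ _ Z) => //; first exact: isproj_orthproj.
  by have := orthproj_id (Defs.support P); rewrite /Defs.support trmxK.
by rewrite hZ /Defs.support trmxK.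
Qed.

(** The library's spectral theorem speaks of [Num.conj], the definitions of [conjc]. Both yield
    $|z|^2$ when multiplied by $z$, so they agree after cancelling a nonzero $z$. *)
Lemma conjCE (z : C) : Num.conj z = conjc z.
Proof.
have [->|z0] := eqVneq z 0; first by rewrite !rmorph0.
by apply: (mulfI z0); rewrite -normCK sqr_normc.
Qed.

Lemma trmxC_mxH m n (A : 'M[C]_(m, n)) : map_mx Num.conj (A^T) = mxH A.
Proof. by apply/matrixP => i j; rewrite !mxE conjCE. Qed.

Lemma herm_eigdec n (A : 'M[C]_n) : mxH A = A -> exists U q, eigdec A U q.
Proof.
move=> hA; pose P := spectralmx A.
have uP : P *m mxH P = 1%:M.
  by have /unitarymxP := spectral_unitarymx A; rewrite trmxC_mxH.
have Hh : A \is hermsymmx.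
  by apply/is_hermitianmxP; rewrite expr0 scale1r trmxC_mxH.
have /hermitian_spectral_diag_real := Hh.
have /hermitian_normalmx/orthomx_spectralP := Hh; rewrite -/P.
have -> : invmx P = mxH P by rewrite invmx_unitary ?spectral_unitarymx ?trmxC_mxH.
move=> dA /mxOverP re.
exists (mxH P), (fun s => reC (spectral_diag A 0 s)).
rewrite /eigdec mxHK; split; first by apply: mulmx1C.
split; first exact: uP.
rewrite [LHS]dA; congr (_ *m diag_mx _ *m _).
by apply/rowP => j; rewrite !mxE toCE RRe_real //.
Qed.

(** [eigvals] lists the roots of the characteristic polynomial in an unspecified order, so equality
    can hold only up to permutation. The polynomial is invariant under conjugation by [U], and a
    split monic polynomial determines its roots with multiplicity. *)
Lemma eigvals_eigdec n (A U : 'M[C]_n) q : eigdec A U q ->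
  perm_eq (eigvals A) [seq toC (q i) | i <- enum 'I_n].
Proof.
move=> [u1 [u2 ->]]; set D := diag_mx _.
have uP : map_mx polyC U *m map_mx polyC (mxH U) = 1%:M.
  by rewrite -(map_mx1 (@polyC C)) -u1 map_mxM.
have cp : char_poly (U *m D *m mxH U) = char_poly D.
  rewrite /char_poly /char_poly_mx.
  have -> : 'X%:M - map_mx polyC (U *m D *m mxH U) =
    map_mx polyC U *m ('X%:M - map_mx polyC D) *m map_mx polyC (mxH U).
    by rewrite mulmxBr mulmxBl (scalar_mxC 'X (map_mx polyC U)) -[_%:M *m _ *m _]mulmxA uP mulmx1 !map_mxM.
  by rewrite !det_mulmx mulrAC -det_mulmx uP det1 mul1r.
rewrite /eigvals; case: closed_field_poly_normal => s /= hs.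
move: hs; rewrite (monicP (char_poly_monic _)) scale1r cp char_poly_trig ?diag_mx_is_trig //.
move=> e; apply/prod_XsubC_eq; rewrite -e big_map big_enum /=.
by apply: eq_bigr => i _; rewrite !mxE eqxx mulr1n.
Qed.

Lemma mem_eigvals n (A U : 'M[C]_n) q i : eigdec A U q -> toC (q i) \in eigvals A.
Proof.
move=> /eigvals_eigdec/perm_mem ->; apply/mapP; exists i => //; exact: mem_enum.
Qed.

Definition dg n (f : 'I_n -> R) : 'M[C]_n := diag_mx (\row_s toC (f s)).

Lemma dgM n (f g : 'I_n -> R) : dg f *m dg g = dg (fun i => f i * g i).
Proof.
apply/matrixP => i j; rewrite mul_diag_mx !mxE toCM.
by case: (i == j); rewrite ?mulr1n ?mulr0n ?mulr0.
Qed.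

Lemma mxH_dg n (f : 'I_n -> R) : mxH (dg f) = dg f.
Proof. exact: mxH_diag. Qed.

Lemma eq_dg n (f g : 'I_n -> R) : f =1 g -> dg f = dg g.
Proof. by move=> h; rewrite /dg; congr diag_mx; apply/rowP => j; rewrite !mxE h. Qed.

Lemma dg1 n : dg (fun _ : 'I_n => 1) = 1%:M.
Proof. by apply/matrixP => i j; rewrite !mxE. Qed.

Section Sandwich.
Variables (n : nat) (U : 'M[C]_n).
Hypothesis unitary_U : mxH U *m U = 1%:M.

(** Functional calculus in the eigenbasis [U]: products become pointwise products of eigenvalue
    functions, and pointwise inequalities give the Loewner order. *)
Definition sw f := U *m dg f *m mxH U.

Lemma swM f g : sw f *m sw g = sw (fun i => f i * g i).
Proof. by rewrite /sw -dgM !mulmxA -(mulmxA _ _ U) unitary_U mulmx1. Qed.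
Lemma mxH_sw f : mxH (sw f) = sw f.
Proof. by rewrite /sw !mxHM mxHK mxH_dg mulmxA. Qed.
Lemma eq_sw f g : f =1 g -> sw f = sw g.
Proof. by move=> h; rewrite /sw (eq_dg h). Qed.
Lemma lop_sw f g : (forall i, f i <= g i) -> lop (sw f) (sw g).
Proof. exact: lop_diag. Qed.
Lemma isproj_sw (b : 'I_n -> bool) : isproj (sw (fun i => (b i)%:R)).
Proof.
split; first exact: mxH_sw.
by rewrite swM; apply: eq_sw => i; case: (b i); rewrite ?mulr1 ?mulr0.
Qed.
Lemma rtr_sw f : rtr (sw f) = \sum_i f i.
Proof.
rewrite /sw rtr_mulC mulmxA unitary_U mul1mx /rtr mxtrace_diag reC_sum.
by apply: eq_bigr => i _; rewrite mxE.
Qed.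

End Sandwich.

Lemma sw1 n (U : 'M[C]_n) : U *m mxH U = 1%:M -> sw U (fun=> 1) = 1%:M.
Proof. by rewrite /sw dg1 mulmx1. Qed.

Lemma swB n (U : 'M[C]_n) f g : sw U (fun i => f i - g i) = sw U f - sw U g.
Proof.
rewrite /sw -mulmxBl -mulmxBr /dg -raddfB; congr (_ *m diag_mx _ *m _).
by apply/rowP => j; rewrite !mxE toCD !toCE rmorphN.
Qed.
Lemma swZ n (U : 'M[C]_n) r f : sw U (fun i => r * f i) = toC r *: sw U f.
Proof.
rewrite /sw scalemxAl scalemxAr; congr (_ *m _ *m _).
by apply/matrixP => i j; rewrite !mxE toCM mulrnAr.
Qed.

(** In eigenbasis coordinates, a row of an eigenspace for [a >= t] is supported where [q] equals
    [a]. Conversely the [j]-th eigenvector with [t <= q j] lies in the eigenspace of [q j], which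
    the sum over [eigvals] visits. *)
Lemma eigspan_geE n (M U : 'M[C]_n) q t : eigdec M U q ->
  (eigspan_ge M t :=: (sw U (fun i => (t <= q i)%R%:R))^T)%MS.
Proof.
move=> e; have [u1 [u2 Me]] := e; set E := sw _ _.
have uT : (mxH U)^T *m U^T = 1%:M by rewrite -trmx_mul u1 trmx1.
have uT2 : U^T *m (mxH U)^T = 1%:M by rewrite -trmx_mul u2 trmx1.
have MT : M^T = (mxH U)^T *m dg q *m U^T by rewrite Me !trmx_mul tr_diag_mx mulmxA.
have ET : E^T = (mxH U)^T *m dg (fun i => (t <= q i)%R%:R) *m U^T.
  by rewrite !trmx_mul tr_diag_mx mulmxA.
apply/eqmxP/andP; split.
  rewrite /eigspan_ge big_seq_cond.
  apply: (big_ind (fun A : 'M_n => (A <= E^T)%MS)); first exact: sub0mx.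
    by move=> A B hA hB; rewrite addsmx_sub hA hB.
  move=> a /andP[_ ta]; have : eigenspace M^T a *m M^T = a *: eigenspace M^T a by apply/eigenspaceP.
  move: (eigenspace M^T a) => W hW.
  (* A nonzero entry in column [j] forces [q j = a], hence [t <= q j], so the indicator leaves it
     unchanged. *)
  have key (Y : 'M_n) : Y *m dg q = a *: Y -> Y *m dg (fun i => (t <= q i)%R%:R) = Y.
    move=> hY; apply/matrixP => i j; rewrite mul_mx_diag !mxE.
    have := congr1 (fun A : 'M_n => A i j) hY; rewrite /= mul_mx_diag !mxE.
    have [->|y0] := eqVneq (Y i j) 0; first by rewrite !mul0r.
    rewrite [a * _]mulrC => /(mulfI y0) qa.
    by move: ta; rewrite -qa !toCE lecR => ->; rewrite rmorph1 mulr1.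
  have hY : (W *m (mxH U)^T) *m dg q = a *: (W *m (mxH U)^T).
    by rewrite scalemxAl -hW MT -!mulmxA uT2 mulmx1.
  have {}hY := key _ hY; rewrite ET; apply/submxP; exists W.
  rewrite 2!mulmxA.
  rewrite hY.
  rewrite -mulmxA.
  by rewrite uT mulmx1.
rewrite ET -mulmxA; apply: submx_trans (submxMl _ _) _; apply/row_subP => j.
set v := row j _.
have hv : v = toC (t <= q j)%R%:R *: row j U^T.
  by apply/rowP => k; rewrite /v mul_diag_mx !mxE.
rewrite hv; case: (boolP (t <= q j)) => tq; last by rewrite toC0 scale0r sub0mx.
rewrite scale1r.
have me : toC (q j) \in eigvals M := mem_eigvals j e.
rewrite /eigspan_ge (big_rem _ me) /= !toCE lecR tq -toCE.
apply: submx_trans (addsmxSl _ _); apply/eigenspaceP.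
rewrite MT !mulmxA -row_mul uT2 row1 -rowE.
by apply/rowP => k; rewrite -row_mul mul_diag_mx !mxE.
Qed.

End Subspaces.

(** * The tilted projector *)

Section Tilted.
Variable R : realType.
Local Notation C := R[i].
Variables (N : nat) (A B : 'M[C]_N) (t : R).
Hypotheses (pA : isproj A) (pB : isproj B) (t0 : 0 < t) (t1 : t < 1).

(** The decoding projector of the scheme: [A] and [B] are the projectors on
    the subspaces [A'] and [B'], and [t = 1 - sqrt eps]. *)
Definition tilted := orthproj (eigspan_ge (A *m B *m A) t *m B^T).

Lemma isproj_tilted : isproj tilted.
Proof. exact: isproj_orthproj. Qed.

Section Spectral.
Variables (M E U : 'M[C]_N) (q : 'I_N -> R).
Hypotheses (defM : M = A *m B *m A) (eM : eigdec M U q)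
  (defE : E = sw U (fun i => (t <= q i)%R%:R)).

Lemma tilted_herm : mxH M = M.
Proof. by rewrite defM !mxHM pA.1 pB.1 mulmxA. Qed.

Lemma ip_tiltedM m (S : 'M[C]_(N, m)) : ip S (M *m S) = hs (B *m (A *m S)).
Proof. by rewrite (hs_proj pB) [RHS]ipC [RHS]ip_adj pA.1 [RHS]ipC defM !mulmxA. Qed.

Lemma MswE : M = sw U q. Proof. by case: eM => _ []. Qed.

Lemma tilted_unitary : mxH U *m U = 1%:M. Proof. by case: eM => _ []. Qed.

(** Test on the spectral projector [F] of the eigenvalues above 1: $|BAF|^2\le|F|^2$ says that the
    sum of $q_i-1$ over these eigenvalues is nonpositive, which leaves none. *)
Lemma tilted_eig_le1 i : q i <= 1.
Proof.
pose F := sw U (fun i => (1 < q i)%R%:R).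
have pF : isproj F := isproj_sw tilted_unitary _.
have h : ip F (M *m F) <= hs F.
  by rewrite ip_tiltedM; apply: le_trans (hs_proj_le pB _) (hs_proj_le pA _).
move: h; rewrite (hs_proj_rtr pF) /ip pF.1 MswE !(swM tilted_unitary) !(rtr_sw tilted_unitary) -subr_le0 -sumrB => h.
rewrite leNgt; apply/negP => qi; move: h; rewrite leNgt => /negP; apply.
rewrite (bigD1 i) //= qi mul1r mulr1; apply: ltr_pwDl; first by rewrite subr_gt0.
apply: sumr_ge0 => j _; case: (ltP 1 (q j)) => hj; last by rewrite mul0r subr0.
by rewrite mul1r mulr1 subr_ge0 ltW.
Qed.

(** The eigenvalues kept by [E] are at least [t > 0] and can be inverted, so [E] factors through [M]
    and its range lies in that of [A]. *)
Lemma tilted_AE : A *m E = E.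
Proof.
have -> : E = M *m sw U (fun i => (t <= q i)%R%:R / q i).
  rewrite MswE (swM tilted_unitary) defE; apply: eq_sw => i.
  case: (leP t (q i)) => h; last by rewrite mul0r mulr0.
  by rewrite mul1r mulfV // gt_eqF // (lt_le_trans t0).
by rewrite defM !mulmxA pA.2.
Qed.

Lemma tilted_range : exists Z, tilted = B *m E *m Z.
Proof.
have /eqmxP/andP[/submxP[D hD] _] := eigspan_geE t eM.
have [Z hZ] := orthproj_factor (eigspan_ge M t *m B^T).
exists (D^T *m Z).
by rewrite /tilted -defM hZ hD -defE trmx_mul trmxK trmx_mul trmxK !mulmxA.
Qed.

Lemma tilted_id : tilted *m (B *m E) = B *m E.
Proof.
have /eqmxP/andP[_ /submxP[D hD]] := eigspan_geE t eM.
have h := orthproj_id (eigspan_ge M t *m B^T).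
have -> : B *m E = (eigspan_ge M t *m B^T)^T *m D^T.
  by rewrite -trmx_mul mulmxA -hD -defE trmx_mul !trmxK.
by rewrite mulmxA /tilted -defM h.
Qed.

(** Since [A E = E], one has [n (B E) = B (A B A) E = B E M]: the range of [B E], which is that of
    [tilted], is invariant under the Hermitian [n]. A Hermitian operator preserving the range of a
    projector commutes with it. *)
Lemma tilted_comm n : n = B *m A *m B -> tilted *m n = n *m tilted.
Proof.
move=> defn.
have ME : M *m E = E *m M.
  by rewrite MswE defE !(swM tilted_unitary); apply: eq_sw => i; rewrite mulrC.
have nH : mxH n = n by rewrite defn !mxHM pA.1 pB.1 mulmxA.
have [Z hZ] := tilted_range.
have h : n *m tilted = B *m E *m (M *m Z).
  rewrite hZ -[RHS]mulmxA (mulmxA E M) -ME defM -{1}tilted_AE defn.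
  by rewrite -!mulmxA (mulmxA B B) pB.2.
have h2 : tilted *m (n *m tilted) = n *m tilted by rewrite h mulmxA tilted_id.
move: tilted isproj_tilted h2 {h hZ} => T pT h2.
by have := congr1 (@mxH R _ _) h2; rewrite !mxHM pT.1 nH -mulmxA h2 => ->.
Qed.

Lemma isproj_E : isproj E.
Proof. by rewrite defE; exact: isproj_sw tilted_unitary _. Qed.

(** The two squared norms are the values at [z] of the forms [E M E] and [E M^2 E], and $q^2\ge tq$
    for every eigenvalue $q\ge t$. *)
Lemma hs_tilted_core m (z : 'M[C]_(N, m)) :
  t * hs (B *m (E *m z)) <= hs (A *m (B *m (E *m z))).
Proof.
have -> : hs (B *m (E *m z)) = ip z (sw U (fun i => (t <= q i)%R%:R * (q i * (t <= q i)%R%:R)) *m z).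
  rewrite -{1}tilted_AE -mulmxA -ip_tiltedM -!(swM tilted_unitary) -MswE -defE.
  by rewrite -!mulmxA [RHS]ip_adj isproj_E.1.
have -> : hs (A *m (B *m (E *m z))) =
   ip z (sw U (fun i => (t <= q i)%R%:R * (q i * (q i * (t <= q i)%R%:R))) *m z).
  have -> : A *m (B *m (E *m z)) = M *m (E *m z).
    by rewrite -{1}tilted_AE defM !mulmxA.
  rewrite -!(swM tilted_unitary) -MswE -defE -!mulmxA [RHS]ip_adj isproj_E.1.
  by rewrite [RHS]ip_adj tilted_herm.
rewrite -ipZr scalemxAl -swZ; apply: lop_sw => i.
case: (leP t (q i)) => h; last by rewrite !mul0r mulr0.
rewrite !mul1r !mulr1 ler_wpM2r //; exact: ltW (lt_le_trans t0 h).
Qed.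

(** Split [S] along [tilted] and its complement. As [tilted] commutes with [B A B], the cross term
    in $|ABS|^2$ vanishes, and the part inside the range is at least $t$ times its squared norm by
    [hs_tilted_core]. *)
Lemma lop_tilted_aux : lop tilted (toC t^-1 *: (B *m A *m B)).
Proof.
move=> m S; rewrite -scalemxAl ipZr -(hs_proj isproj_tilted).
have -> : ip S (B *m A *m B *m S) = hs (A *m (B *m S)).
  by rewrite (hs_proj pA) -!mulmxA ip_adj pB.1.
rewrite ler_pdivlMl //.
have [Z hZ] := tilted_range.
apply: le_trans (_ : hs (A *m (B *m (tilted *m S))) <= _).
  by have := hs_tilted_core (Z *m S); rewrite hZ -!mulmxA (mulmxA B B) pB.2.
have := isproj_tilted; have := tilted_comm erefl.
move: tilted => T Tc pT; pose Q := 1%:M - T.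
have -> : A *m (B *m S) = A *m (B *m (T *m S)) + A *m (B *m (Q *m S)).
  by rewrite -!mulmxDr -mulmxDl /Q addrC subrK mul1mx.
rewrite [leRHS]hsD.
have -> : ip (A *m (B *m (T *m S))) (A *m (B *m (Q *m S))) = 0.
  have z : T *m (B *m (A *m (B *m (Q *m S)))) = 0.
    rewrite (_ : _ *m _ = T *m (B *m A *m B) *m Q *m S); last by rewrite !mulmxA.
    by rewrite Tc -(mulmxA _ T) /Q mulmxBr mulmx1 pT.2 subrr mulmx0 mul0mx.
  rewrite /ip !mxHM pA.1 pB.1 pT.1 -!mulmxA (mulmxA A A) pA.2 z.
  by rewrite mulmx0 /rtr mxtrace0.
by rewrite mulr0 addr0 lerDl hs_ge0.
Qed.

(** The vector [B E S] is fixed by [tilted], so the loss is at most $|S-BES|^2$, where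
    $S-BES=(1-B)S+B(1-E)S$. Because eigenvalues are at most 1, $(1-t)(1-E)\le 1-M$, and Pythagoras
    turns $|S|^2-|BAS|^2$ into $|(1-A)S|^2+|(1-B)AS|^2$. Applying $|u+v|^2\le2|u|^2+2|v|^2$ twice
    produces the constant 6. *)
Lemma hs_tiltedC_aux m (S : 'M[C]_(N, m)) :
  hs ((1%:M - tilted) *m S) <=
  6 / (1 - t) * (hs ((1%:M - A) *m S) + hs ((1%:M - B) *m S)).
Proof.
have pT := isproj_tilted.
have -> : (1%:M - tilted) *m S = (1%:M - tilted) *m (S - B *m (E *m S)).
  rewrite mulmxBr [X in _ = _ - X]mulmxBl mul1mx (mulmxA B E) (mulmxA tilted) tilted_id.
  by rewrite subrr subr0.
apply: le_trans (hs_proj_le (isprojC pT) _) _.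
have -> : S - B *m (E *m S) = (1%:M - B) *m S + B *m ((1%:M - E) *m S).
  rewrite !mulmxBl !mul1mx mulmxBr addrA subrK //.
apply: le_trans (hsD_le _ _) _.
have h1 := hs_proj_le pB ((1%:M - E) *m S).
have h2 : (1 - t) * hs ((1%:M - E) *m S) <= hs ((1%:M - A) *m S) + hs ((1%:M - B) *m (A *m S)).
  have u1 : U *m mxH U = 1%:M by case: eM.
  rewrite (hs_projC pB) (hs_projC pA) addrA subrK -ip_tiltedM.
  rewrite (hs_proj (isprojC isproj_E)) -ipZr.
  have -> : hs S - ip S (M *m S) = ip S (sw U (fun i => 1 - q i) *m S).
    by rewrite swB sw1 // mulmxBl mul1mx ipBr MswE.
  rewrite scalemxAl defE -(sw1 u1) -swB -swZ; apply: lop_sw => i.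
  have := tilted_eig_le1 i; case: (leP t (q i)) => h q1; rewrite ?subrr ?subr0; lra.
have h3 : hs ((1%:M - B) *m (A *m S)) <= 2 * hs ((1%:M - B) *m S) + 2 * hs ((1%:M - A) *m S).
  have -> : (1%:M - B) *m (A *m S) = (1%:M - B) *m S + (- ((1%:M - B) *m ((1%:M - A) *m S))).
    by rewrite -mulmxBr; congr (_ *m _); rewrite mulmxBl mul1mx opprB addrCA subrr addr0.
  apply: le_trans (hsD_le _ _) _; rewrite [X in _ + 2 * X]hsN lerD2l ler_pM2l; last exact: ltr0n.
  exact: hs_proj_le (isprojC pB) _.
move: h1 h2 h3 (hs_ge0 ((1%:M - A) *m S)) (hs_ge0 ((1%:M - B) *m S)).
move: (hs ((1%:M - A) *m S)) (hs ((1%:M - B) *m S)) (hs ((1%:M - B) *m (A *m S))) (hs (B *m ((1%:M - E) *m S))) (hs ((1%:M - E) *m S)).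
move=> a c f b e h1 h2 h3 a0 c0.
have t' : 0 < 1 - t by rewrite subr_gt0.
rewrite mulrAC ler_pdivlMr //.
have h4 : (1 - t) * b <= (1 - t) * e by rewrite ler_pM2l.
have h5 : (1 - t) * c <= c by rewrite ler_piMl // gerBl ltW.
lra.
Qed.

End Spectral.

Lemma tilted_spectral : exists U q, eigdec (A *m B *m A) U q.
Proof. by apply: herm_eigdec; exact: tilted_herm. Qed.

Lemma lop_tilted : lop tilted (toC t^-1 *: (B *m A *m B)).
Proof. have [U [q h]] := tilted_spectral; exact: (lop_tilted_aux erefl h erefl). Qed.

Lemma hs_tiltedC m (S : 'M[C]_(N, m)) :
  hs ((1%:M - tilted) *m S) <=
  6 / (1 - t) * (hs ((1%:M - A) *m S) + hs ((1%:M - B) *m S)).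
Proof. have [U [q h]] := tilted_spectral; exact: (hs_tiltedC_aux erefl h erefl). Qed.

End Tilted.

(** * Noncommutative union bound *)

Section UnionBound.
Variable R : realType.
Local Notation C := R[i].
Variables (n : nat) (I : Type) (Q : I -> 'M[C]_n).
Hypothesis pQ : forall i, isproj (Q i).

Definition seqmeas m (S : 'M[C]_(n, m)) (s : seq I) := foldl (fun T i => Q i *m T) S s.

Lemma seqmeasE m (S : 'M[C]_(n, m)) s : seqmeas S s = seqmeas 1%:M s *m S.
Proof.
elim/last_ind: s => [|s i IH]; first by rewrite /seqmeas /= mul1mx.
by rewrite /seqmeas !foldl_rcons -/(seqmeas S s) -/(seqmeas 1%:M s) IH mulmxA.
Qed.

Lemma seqmeas_rcons m (S : 'M[C]_(n, m)) s i : seqmeas S (rcons s i) = Q i *m seqmeas S s.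
Proof. by rewrite /seqmeas foldl_rcons. Qed.

Lemma hs_seqmeas_le m (S : 'M[C]_(n, m)) s : hs (seqmeas S s) <= hs S.
Proof.
elim/last_ind: s => [|s i IH]; first exact: lexx.
by rewrite seqmeas_rcons; apply: le_trans (hs_proj_le (pQ i) _) IH.
Qed.

(** Comparing [S] with its image through the overlap [ip S _], instead of through
    norms, makes the final bound linear in the losses: no square root appears. *)
Lemma seqmeas_overlap m (S : 'M[C]_(n, m)) s :
  2 * ip S (S - seqmeas S s) <=
  2 * \sum_(i <- s) hs ((1%:M - Q i) *m S) + 2^-1 * (hs S - hs (seqmeas S s)).
Proof.
elim/last_ind: s => [|s i IH]; first by rewrite big_nil /seqmeas /= !subrr /ip mulmx0 /rtr mxtrace0 !mulr0 addr0.
rewrite seqmeas_rcons big_rcons /=; move: (seqmeas S s) IH => v.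
have pC := isprojC (pQ i).
have -> : S - Q i *m v = (S - v) + (1%:M - Q i) *m v by rewrite mulmxBl mul1mx addrA subrK.
rewrite [ip S (_ + _ *m v)]ipDr -(proj_ip pC).
(* With weight 2 the second term is half of $|(1-Q_i)v|^2=|v|^2-|Q_iv|^2$, which telescopes along
   the sequence. *)
have := ip_le ((1%:M - Q i) *m S) ((1%:M - Q i) *m v) (ltr0n R 2).
rewrite [hs (_ *m v)](hs_projC (pQ i)).
move: (ip _ _) (ip _ _) (hs _) (hs v) (hs _) (hs _) (\sum_(_ <- _) _).
move=> a b c d e f g; lra.
Qed.

(** Expanding $|S-v|^2\ge0$ gives $|S|^2-|v|^2\le2\langle S,S-v\rangle$. The overlap bound returns
    half of the left side, which is absorbed and doubles the factor 2 to 4. *)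
Lemma gao_union_bound m (S : 'M[C]_(n, m)) s :
  hs S - hs (seqmeas S s) <= 4 * \sum_(i <- s) hs ((1%:M - Q i) *m S).
Proof.
have := seqmeas_overlap S s; have := hs_ge0 (S - seqmeas S s).
rewrite hsB ipBr -/(hs S).
move: (hs S) (ip _ _) (hs _) (\sum_(_ <- _) _) => a b c d; lra.
Qed.

End UnionBound.

(** * Sequential decoding of a state analysed through its compression *)

Section Flattened.
Variable R : realType.
Local Notation C := R[i].
Variables (n m : nat) (I : Type) (P : I -> 'M[C]_n) (G1 G2 : 'M[C]_n) (S : 'M[C]_(n, m)).
Hypotheses (pP : forall i, isproj (P i)) (p1 : isproj G1) (p2 : isproj G2).

Let T := G2 *m (G1 *m S).
Let e1 := hs ((1%:M - G1) *m S).
Let e2 := hs ((1%:M - G2) *m S).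

(** The two parts of [S - T] lost to [G2] and to [G1] are orthogonal. *)
Lemma flatten_dist : hs (T - S) <= e1 + e2.
Proof.
have -> : T - S = - ((1%:M - G2) *m S + G2 *m ((1%:M - G1) *m S)).
  by rewrite !mulmxBl !mul1mx mulmxBr addrA subrK opprB.
rewrite hsN hsD.
have -> : ip ((1%:M - G2) *m S) (G2 *m ((1%:M - G1) *m S)) = 0.
  by rewrite ip_adj p2.1 mulmxA mulmxBr mulmx1 p2.2 subrr mul0mx ipC /ip mulmx0 /rtr mxtrace0.
have := hs_proj_le p2 ((1%:M - G1) *m S); rewrite -/e1 -/e2.
by move: (e1) (e2) (hs _) => a b c; lra.
Qed.

Lemma flatten_loss : hs S - hs T <= 3 * e1 + 2 * e2.
Proof.
have h1 : hs S - hs (G1 *m S) = e1 by rewrite -hs_projC.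
have h2 : hs (G1 *m S) - hs T <= 2 * e2 + 2 * e1.
  rewrite -(hs_projC p2).
  have -> : (1%:M - G2) *m (G1 *m S) = (1%:M - G2) *m S + (- ((1%:M - G2) *m ((1%:M - G1) *m S))).
    by rewrite -mulmxBr; congr (_ *m _); rewrite mulmxBl mul1mx opprB addrCA subrr addr0.
  apply: le_trans (hsD_le _ _) _; rewrite lerD2l ler_pM2l ?ltr0n // hsN.
  exact: hs_proj_le (isprojC p2) _.
move: h1 h2; move: (e1) (e2) (hs S) (hs _) (hs _) => a b c d e; lra.
Qed.

(** The union bound is applied to the compressed [T], for which wrong acceptances are small,
    although the decoder acts on [S]. The transfer back expands $|WT|^2$ around $WS$ with Young
    weight [tau] and uses that [W] is a contraction. In the constant 12, 3 comes from
    [flatten_loss], 8 from the correct test moved from [T] to [S], and 1 from the transfer. *)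
Lemma sequential_error (s : seq I) k (tau : R) : 0 < tau ->
  hs S - hs (P k *m foldl (fun acc i => (1%:M - P i) *m acc) 1%:M s *m S) <=
  tau * hs S + (tau^-1 + 12) * (e1 + e2) + 8 * hs ((1%:M - P k) *m S)
  + 4 * \sum_(i <- s) hs (P i *m T).
Proof.
(* [Some i] is the rejection of a wrong candidate and [None] the final acceptance, so the whole run
   is one sequence of projectors. *)
move=> tau0; pose Q (o : option I) := if o is Some i then 1%:M - P i else P k.
have pQ o : isproj (Q o) by case: o => [i|] /=; [exact: isprojC | exact: pP].
pose l := rcons (map Some s) None.
have WE : P k *m foldl (fun acc i => (1%:M - P i) *m acc) 1%:M s = seqmeas Q 1%:M l.
  rewrite seqmeas_rcons /=; congr (_ *m _); rewrite /seqmeas; elim/last_ind: s {l} => // s i IH.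
  by rewrite map_rcons !foldl_rcons IH.
rewrite WE -seqmeasE.
have hT := gao_union_bound pQ T l.
have sE : \sum_(i <- l) hs ((1%:M - Q i) *m T) = \sum_(i <- s) hs (P i *m T) + hs ((1%:M - P k) *m T).
  rewrite big_rcons /= big_map; congr (_ + _); apply: eq_bigr => i _ /=.
  by rewrite opprB addrCA subrr addr0.
have hk : hs ((1%:M - P k) *m T) <= 2 * hs ((1%:M - P k) *m S) + 2 * hs (T - S).
  have -> : (1%:M - P k) *m T = (1%:M - P k) *m S + (1%:M - P k) *m (T - S).
    by rewrite -mulmxDr addrCA subrr addr0.
  apply: le_trans (hsD_le _ _) _; rewrite lerD2l ler_pM2l ?ltr0n //.
  exact: hs_proj_le (isprojC (pP k)) _.
have hW : hs (seqmeas Q T l) <= hs (seqmeas Q S l) + tau * hs S + (1 + tau^-1) * hs (T - S).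
  have -> : seqmeas Q T l = seqmeas Q S l + seqmeas Q (T - S) l.
    by rewrite (seqmeasE Q T) (seqmeasE Q S) (seqmeasE Q (T - S)) -mulmxDr addrCA subrr addr0.
  rewrite hsD.
  have := ip_le (seqmeas Q S l) (seqmeas Q (T - S) l) tau0.
  have a1 : tau * hs (seqmeas Q S l) <= tau * hs S by rewrite ler_pM2l ?hs_seqmeas_le.
  have a2 : (1 + tau^-1) * hs (seqmeas Q (T - S) l) <= (1 + tau^-1) * hs (T - S).
    by rewrite ler_wpM2l ?hs_seqmeas_le // addr_ge0 // invr_ge0 ltW.
  rewrite mulrDl mul1r in a2.
  move: a1 a2; move: (tau * hs (seqmeas Q S l)) (tau * hs S) (tau^-1 * hs (seqmeas Q (T - S) l)).
  move: ((1 + tau^-1) * hs (T - S)) (ip _ _) (hs (seqmeas Q S l)) (hs (seqmeas Q (T - S) l)).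
  move=> a b c d e f g; lra.
have h4 := flatten_dist; have h5 := flatten_loss.
have h6 : (tau^-1 + 9) * hs (T - S) <= (tau^-1 + 9) * (e1 + e2).
  by rewrite ler_wpM2l // addr_ge0 // invr_ge0 ltW.
have := hs_ge0 ((1%:M - G1) *m S); have := hs_ge0 ((1%:M - G2) *m S); rewrite -/e1 -/e2.
rewrite sE in hT; move: hT hk hW h4 h5 h6.
move: (tau^-1) (tau * hs S) (hs (T - S)) (hs ((1%:M - P k) *m T)) (hs ((1%:M - P k) *m S)).
move: (hs T) (hs S) (hs (seqmeas Q T l)) (hs (seqmeas Q S l)).
move: (\sum_(i <- s) hs (P i *m T)) (e1) (e2) => *; lra.
Qed.

Lemma sequential_error_state (sigma W : 'M[C]_n) (s : seq I) k (tau : R) :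
  S *m mxH S = sigma -> rtr sigma = 1 -> 0 < tau ->
  W = P k *m foldl (fun acc i => (1%:M - P i) *m acc) 1%:M s ->
  1 - rtr (W *m sigma *m mxH W) <=
  tau + (tau^-1 + 12) * (e1 + e2) + 8 * hs ((1%:M - P k) *m S)
  + 4 * \sum_(i <- s) hs (P i *m T).
Proof.
move=> Ss tr1 tau0 defW; have := sequential_error s k tau0; rewrite -defW.
have -> : rtr (W *m sigma *m mxH W) = hs (W *m S).
  by rewrite /hs /ip [RHS]rtr_mulC mxHM -Ss !mulmxA.
have -> : hs S = 1 by rewrite /hs /ip rtr_mulC Ss.
by rewrite mulr1.
Qed.

End Flattened.

(** * Tensor powers *)

Section Tensor.
Variable R : realType.
Local Notation C := R[i].

Section Fmx.
Variable K : finType.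
Implicit Types f g : K -> K -> C.

Lemma big_enum_val_all (V : nmodType) (F : K -> V) :
  \sum_(i < #|K|) F (enum_val i) = \sum_k F k.
Proof. by rewrite [RHS](reindex (@enum_val K xpredT)) //; apply: onW_bij; exact: enum_val_bij. Qed.

Lemma fmxM f g : fmx f *m fmx g = fmx (fun k l => \sum_j f k j * g j l).
Proof.
apply/matrixP => i j; rewrite !mxE -(big_enum_val_all (fun k => f (enum_val i) k * g k (enum_val j))).
by apply: eq_bigr => k _; rewrite !mxE.
Qed.

Lemma mxH_fmx f : mxH (fmx f) = fmx (fun k l => conjc (f l k)).
Proof. by apply/matrixP => i j; rewrite !mxE. Qed.

Lemma eq_fmx f g : (forall k l, f k l = g k l) -> fmx f = fmx g.
Proof. by move=> h; apply/matrixP => i j; rewrite !mxE. Qed.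

Lemma fmx1 : fmx (fun k l : K => (k == l)%:R : C) = 1%:M.
Proof. by apply/matrixP => i j; rewrite !mxE (inj_eq enum_val_inj). Qed.

Lemma fmx_dg (q : K -> R) :
  fmx (fun k l => toC (q k) *+ (k == l)) = dg (fun i => q (enum_val i)).
Proof. by apply/matrixP => i j; rewrite !mxE (inj_eq enum_val_inj). Qed.

Lemma fmx_sum I (s : seq I) (P : pred I) (F : I -> K -> K -> C) :
  \sum_(i <- s | P i) fmx (F i) = fmx (fun k l => \sum_(i <- s | P i) F i k l).
Proof.
by apply/matrixP => i j; rewrite summxE !mxE; apply: eq_bigr => k _; rewrite mxE.
Qed.

Lemma fmxZ a f : a *: fmx f = fmx (fun k l => a * f k l).
Proof. by apply/matrixP => i j; rewrite !mxE. Qed.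

End Fmx.

Section Tensn.
Variables n d : nat.
Local Notation Fn := {ffun 'I_n -> 'I_d}.
Implicit Types F G : 'I_n -> 'M[C]_d.

Lemma eq_tensn F G : (forall i, F i = G i) -> tensn F = tensn G.
Proof. by move=> h; apply: eq_fmx => k l; apply: eq_bigr => i _; rewrite h. Qed.

Lemma tensnM F G : tensn F *m tensn G = tensn (fun i => F i *m G i).
Proof.
rewrite /tensn fmxM; apply: eq_fmx => k l.
under [RHS]eq_bigr do rewrite mxE.
by rewrite bigA_distr_bigA /=; apply: eq_bigr => j _; rewrite -big_split.
Qed.

Lemma mxH_tensn F : mxH (tensn F) = tensn (fun i => mxH (F i)).
Proof.
rewrite /tensn mxH_fmx; apply: eq_fmx => k l; rewrite rmorph_prod.
by apply: eq_bigr => i _; rewrite !mxE.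
Qed.

Lemma tensn_dg (q : 'I_n -> 'I_d -> R) :
  tensn (fun i => dg (q i)) = dg (fun k : 'I_(nsys n d) => \prod_i q i ((enum_val k : Fn) i)).
Proof.
rewrite -(fmx_dg (fun k : Fn => \prod_i q i (k i))); apply: eq_fmx => k l.
have [->|kl] := eqVneq k l.
  by rewrite mulr1n toC_prod; apply: eq_bigr => i _; rewrite !mxE eqxx.
have /existsP[i ki] : [exists i, k i != l i].
  by rewrite -negb_forall; apply: contra kl => /forallP h; apply/eqP/ffunP => i; apply/eqP.
by rewrite mulr0n (bigD1 i) //= !mxE (negPf ki) mulr0n mul0r.
Qed.

Lemma tensn1 : tensn (fun _ : 'I_n => 1%:M : 'M[C]_d) = 1%:M.
Proof.
under eq_tensn do rewrite -dg1.
by rewrite tensn_dg -dg1; apply: eq_dg => i; rewrite big1.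
Qed.

(** Multilinearity of the tensor product. This is how averaging over an i.i.d. codeword turns
    $\rho_{x^ny^n}$ into $\rho_{y^n}$ or $\rho_{x^n}$, and the latter into $\rho^{\otimes n}$. *)
Lemma tensn_avg (T : finType) (p : T -> R) (F : 'I_n -> T -> 'M[C]_d) :
  \sum_(w : {ffun 'I_n -> T}) toC (\prod_i p (w i)) *: tensn (fun i => F i (w i)) =
  tensn (fun i => \sum_t toC (p t) *: F i t).
Proof.
rewrite /tensn; under eq_bigr do rewrite fmxZ.
rewrite fmx_sum; apply: eq_fmx => k l.
under [RHS]eq_bigr do rewrite summxE.
rewrite bigA_distr_bigA /=; apply: eq_bigr => w _.
by rewrite toC_prod -big_split; apply: eq_bigr => i _; rewrite !mxE.
Qed.

End Tensn.

Section CondTyp.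
Variables (W : finType) (n d : nat) (sigma U : W -> 'M[C]_d) (q : W -> 'I_d -> R).
Hypothesis dec : forall a, eigdec (sigma a) (U a) (q a).
Implicit Types (w : {ffun 'I_n -> W}) (s : {ffun 'I_n -> 'I_d}).

Definition tU w : 'M[C]_(nsys n d) := tensn (fun i => U (w i)).

Definition tq w (k : 'I_(nsys n d)) : R :=
  \prod_i q (w i) ((enum_val k : {ffun 'I_n -> 'I_d}) i).

Definition ctyp (delta : R) w s : bool :=
  [forall a, (0 < Ncount a w)%N ==>
    [forall b, `| (#|[set i | (w i == a) && (s i == b)]|)%:R
                   / (Ncount a w)%:R - q a b | <= delta * q a b]].

Lemma tU_unitary w : tU w *m mxH (tU w) = 1%:M /\ mxH (tU w) *m tU w = 1%:M.
Proof.
rewrite /tU mxH_tensn !tensnM -tensn1.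
by split; apply: eq_tensn => i; case: (dec (w i)) => ? [].
Qed.

Lemma tensn_eig w : tensn (fun i => sigma (w i)) = sw (tU w) (tq w).
Proof.
have h : dg (tq w) = tensn (fun i => dg (q (w i))) by rewrite tensn_dg.
rewrite /sw /tU mxH_tensn h !tensnM; apply: eq_tensn => i.
by case: (dec (w i)) => _ [].
Qed.

(** The rank-one terms come from the columns of the unitary [tU w], so the projector is an indicator
    in an eigenbasis of the product state. Comparing the two thus reduces to comparing
    eigenvalues. *)
Lemma condtyp_projE delta w :
  condtyp_proj U q delta w = sw (tU w) (fun k => (ctyp delta w (enum_val k))%:R).
Proof.
apply/matrixP => i j; rewrite summxE !mxE big_mkcond /=.
rewrite -(big_enum_val_all (fun s : {ffun 'I_n -> 'I_d} => _)).
apply: eq_bigr => k _; rewrite mul_mx_diag !mxE.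
rewrite -/(ctyp delta w (enum_val k)); case: (ctyp _ _ _); last by rewrite toC0 mulr0 mul0r.
by rewrite big_ord1 toC1 mulr1 !mxE.
Qed.

Lemma isproj_condtyp delta w : isproj (condtyp_proj U q delta w).
Proof. by rewrite condtyp_projE; apply: isproj_sw; case: (tU_unitary w). Qed.

End CondTyp.
End Tensor.

(** * Law of large numbers *)

Section ProductDistr.
Variables (R : realType) (I T : finType) (p : T -> R).
Hypothesis dp : distr p.
Implicit Types c : {ffun I -> T}.

Lemma product_expect (g : I -> T -> R) :
  \sum_(c : {ffun I -> T}) \prod_i p (c i) * \prod_i g i (c i) = \prod_i \sum_t p t * g i t.
Proof. by rewrite bigA_distr_bigA; apply: eq_bigr => c _; rewrite -big_split. Qed.

Lemma product_distr : distr (fun c : {ffun I -> T} => \prod_i p (c i)).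
Proof.
split=> [c|]; first by apply: prodr_ge0 => i _; case: dp.
transitivity (\sum_(c : {ffun I -> T}) \prod_i p (c i) * \prod_(i : I) 1).
  by apply: eq_bigr => c _; rewrite big1_eq mulr1.
rewrite (product_expect (fun _ _ => 1)) big1 // => i _; under eq_bigr do rewrite mulr1.
by case: dp.
Qed.

(** Writing [F] as a combination of indicators of the two coordinates makes each integrand a product
    over coordinates, to which [product_expect] applies. *)
Lemma marginal2 i j (F : T -> T -> R) : i != j ->
  \sum_(c : {ffun I -> T}) \prod_k p (c k) * F (c i) (c j) = \sum_t \sum_u p t * p u * F t u.
Proof.
move=> ij; have ji : j != i by rewrite eq_sym.
have FE c : F (c i) (c j) = \sum_t \sum_u (c i == t)%:R * (c j == u)%:R * F t u.
  rewrite (bigD1 (c i)) //= (bigD1 (c j)) //= !eqxx !mul1r !big1 ?addr0 // => [t tc|u uc].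
    by rewrite big1 // => u _; rewrite eq_sym (negPf tc) !mul0r.
  by rewrite (eq_sym _ u) (negPf uc) mulr0 mul0r.
transitivity (\sum_t \sum_u \sum_(c : {ffun I -> T}) \prod_k p (c k) * ((c i == t)%:R * (c j == u)%:R) * F t u).
  under [RHS]eq_bigr do rewrite exchange_big /=.
  rewrite [RHS]exchange_big /=; apply: eq_bigr => c _.
  rewrite FE mulr_sumr; apply: eq_bigr => t _.
  by rewrite mulr_sumr; apply: eq_bigr => u _; rewrite mulrA.
apply: eq_bigr => t _; apply: eq_bigr => u _; rewrite -mulr_suml; congr (_ * _).
pose g k v : R := if k == i then (v == t)%:R else if k == j then (v == u)%:R else 1.
transitivity (\sum_(c : {ffun I -> T}) \prod_k p (c k) * \prod_k g k (c k)).
  apply: eq_bigr => c _; congr (_ * _); rewrite (bigD1 i) //= (bigD1 j ji) /=.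
  rewrite /g eqxx (negPf ji) eqxx big1 ?mulr1 // => k /andP[/negPf -> /negPf ->] //.
rewrite product_expect (bigD1 i) //= (bigD1 j ji) /=.
have pick v : \sum_x p x * (x == v)%:R = p v.
  rewrite (bigD1 v) //= eqxx mulr1 big1 ?addr0 // => x /negPf ->; by rewrite mulr0.
rewrite [X in _ * (_ * X)]big1 ?mulr1.
  by rewrite /g eqxx (negPf ji) eqxx; congr (_ * _); exact: pick.
move=> k /andP[/negPf ki /negPf kj]; rewrite /g ki kj.
by under eq_bigr do rewrite mulr1; case: dp.
Qed.

Lemma marginal1 i (F : T -> R) :
  \sum_(c : {ffun I -> T}) \prod_k p (c k) * F (c i) = \sum_t p t * F t.
Proof.
have FE c : F (c i) = \sum_t (c i == t)%:R * F t.
  by rewrite (bigD1 (c i)) //= eqxx mul1r big1 ?addr0 // => t tc; rewrite eq_sym (negPf tc) mul0r.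
transitivity (\sum_t \sum_(c : {ffun I -> T}) \prod_k p (c k) * (c i == t)%:R * F t).
  rewrite [RHS]exchange_big /=; apply: eq_bigr => c _.
  by rewrite FE mulr_sumr; apply: eq_bigr => t _; rewrite mulrA.
apply: eq_bigr => t _; rewrite -mulr_suml; congr (_ * _).
pose g k v : R := if k == i then (v == t)%:R else 1.
transitivity (\sum_(c : {ffun I -> T}) \prod_k p (c k) * \prod_k g k (c k)).
  apply: eq_bigr => c _; congr (_ * _); rewrite (bigD1 i) //=.
  by rewrite /g eqxx big1 ?mulr1 // => k /negPf ->.
rewrite product_expect (bigD1 i) //= [X in _ * X]big1 ?mulr1.
  rewrite /g eqxx (bigD1 t) //= eqxx mulr1 big1 ?addr0 // => x /negPf ->; by rewrite mulr0.
by move=> k /negPf ki; rewrite /g ki; under eq_bigr do rewrite mulr1; case: dp.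
Qed.

End ProductDistr.

Section LLN.
Variables (R : realType) (T : finType) (p : T -> R).
Hypothesis dp : distr p.

Lemma distr_le1 t : p t <= 1.
Proof.
by case: dp => p0 <-; rewrite (bigD1 t) //= lerDl; apply: sumr_ge0.
Qed.

Lemma NcountE n a (w : 'I_n -> T) : (Ncount a w)%:R = \sum_i (w i == a)%:R :> R.
Proof.
rewrite /Ncount -sum1_card natr_sum big_mkcond; apply: eq_bigr => i _.
by rewrite inE; case: (w i == a).
Qed.

(** The count deviation is a sum of [n] independent centred variables bounded by 1 in absolute
    value: cross terms vanish and each diagonal term is at most 1. *)
Lemma variance_Ncount n a :
  \sum_(w : {ffun 'I_n -> T}) \prod_i p (w i) * ((Ncount a w)%:R - n%:R * p a) ^+ 2 <= n%:R.
Proof.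
pose x t : R := (t == a)%:R - p a.
have xE (w : {ffun 'I_n -> T}) : (Ncount a w)%:R - n%:R * p a = \sum_i x (w i).
  by rewrite NcountE sumrB sumr_const card_ord mulr_natl.
have x0 : \sum_t p t * x t = 0.
  rewrite /x; under eq_bigr do rewrite mulrBr.
  rewrite sumrB -mulr_suml dp.2 mul1r (bigD1 a) //= eqxx mulr1 big1 ?addr0 ?subrr //.
  by move=> t /negPf ->; rewrite mulr0.
have x1 t : x t ^+ 2 <= 1.
  have := distr_le1 a; have := dp.1 a; rewrite /x; case: (t == a) => /= h1 h2; nra.
have -> : \sum_(w : {ffun 'I_n -> T}) \prod_i p (w i) * ((Ncount a w)%:R - n%:R * p a) ^+ 2 =
  \sum_(w : {ffun 'I_n -> T}) \sum_i \sum_j \prod_k p (w k) * (x (w i) * x (w j)).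
  apply: eq_bigr => w _; rewrite xE expr2 big_distrlr /= mulr_sumr.
  by apply: eq_bigr => i _; rewrite mulr_sumr.
rewrite exchange_big /= -[leRHS]mulr1 mulr_natl -[X in _ *+ X]card_ord -sumr_const.
apply: ler_sum => i _; rewrite exchange_big /= (bigD1 i) //= [X in _ + X]big1 ?addr0.
  rewrite (marginal1 dp i (fun t => x t * x t)) -dp.2; apply: ler_sum => t _.
  by rewrite -[leRHS]mulr1 ler_wpM2l ?dp.1 // -expr2 x1.
move=> j ji; rewrite (marginal2 dp (fun t u => x t * x u)) 1?eq_sym //.
rewrite big1 // => t _; under eq_bigr do rewrite mulrACA.
by rewrite -mulr_sumr x0 mulr0.
Qed.

(** Chebyshev's inequality for each letter, followed by a union bound over the letters. *)
Lemma typical_lln (delta : R) : 0 < delta -> exists2 K : R, 0 <= K &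
  forall n, (0 < n)%N ->
  \sum_(w : {ffun 'I_n -> T}) \prod_i p (w i) * (~~ typical p delta w)%:R <= K / n%:R.
Proof.
move=> d0; exists (\sum_a (delta * p a) ^- 2).
  by apply: sumr_ge0 => a _; rewrite invr_ge0 sqr_ge0.
move=> n n0; have n0' : 0 < n%:R :> R by rewrite ltr0n.
have pn0 (w : {ffun 'I_n -> T}) : 0 <= \prod_i p (w i) := (product_distr _ dp).1 w.
apply: le_trans (_ : \sum_a \sum_(w : {ffun 'I_n -> T})
  \prod_i p (w i) * (delta * p a < `|(Ncount a w)%:R / n%:R - p a|)%R%:R <= _).
  rewrite exchange_big; apply: ler_sum => w _; rewrite -mulr_sumr ler_wpM2l ?pn0 //.
  case: (boolP (typical p delta w)) => [_|]; first by apply: sumr_ge0 => a _; rewrite ler0n.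
  rewrite negb_forall => /existsP[a]; rewrite -ltNge => h.
  by rewrite (bigD1 a) //= h lerDl; apply: sumr_ge0 => b _; rewrite ler0n.
rewrite mulr_suml; apply: ler_sum => a _.
(* For a letter of probability zero Chebyshev would divide by zero. Either it occurs and the
   sequence has weight zero, or its count is exactly as expected; its term in the constant is 0
   since [0^-1 = 0]. *)
have [pa|pa] := eqVneq (p a) 0.
  rewrite big1 ?mulr_ge0 ?invr_ge0 ?sqr_ge0 ?ler0n // => w _.
  have [/existsP[i /eqP wi]|h] := boolP [exists i, w i == a].
    by rewrite (bigD1 i) //= wi pa !mul0r.
  suff -> : Ncount a w = 0%N by rewrite pa mul0r subrr mulr0 normr0 ltxx mulr0.
  apply/eqP; rewrite cards_eq0; apply/eqP/setP => i; rewrite !inE.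
  by move: h; rewrite negb_exists => /forallP/(_ i)/negPf ->.
have pa0 : 0 < p a by rewrite lt0r pa dp.1.
have dpa : 0 < delta * p a by rewrite mulr_gt0.
have key (w : {ffun 'I_n -> T}) : (delta * p a < `|(Ncount a w)%:R / n%:R - p a|)%R%:R <=
   (delta * p a) ^- 2 * n%:R ^- 2 * ((Ncount a w)%:R - n%:R * p a) ^+ 2.
  case: ltP => /= h; last first.
    by apply: mulr_ge0; [apply: mulr_ge0; rewrite invr_ge0 sqr_ge0 | exact: sqr_ge0].
  have -> : (Ncount a w)%:R - n%:R * p a = n%:R * ((Ncount a w)%:R / n%:R - p a).
    by field; rewrite gt_eqF.
  move: (_ / _ - _) h => z h.
  rewrite [(n%:R * z) ^+ 2]exprMn mulrA mulfVK; last by rewrite gt_eqF // exprn_gt0.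
  rewrite mulrC ler_pdivlMr ?exprn_gt0 // mul1r -[z ^+ 2]real_normK ?num_real //.
  by rewrite ler_pXn2r ?nnegrE ?normr_ge0 //; exact: ltW.
apply: le_trans (_ : _ <= \sum_(w : {ffun 'I_n -> T}) (delta * p a) ^- 2 * n%:R ^- 2 *
    (\prod_i p (w i) * ((Ncount a w)%:R - n%:R * p a) ^+ 2)) _.
  apply: ler_sum => w _; rewrite mulrCA ler_wpM2l ?pn0 //.
rewrite -mulr_sumr; apply: le_trans (ler_wpM2l _ (variance_Ncount n a)) _.
  by rewrite mulr_ge0 ?invr_ge0 ?sqr_ge0.
by rewrite -mulrA ler_wpM2l ?invr_ge0 ?sqr_ge0 // expr2 invfM mulfVK ?gt_eqF.
Qed.

End LLN.

(** * Conditional typicality *)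

Section Zip.
Variable R : realType.

Lemma big_zip (n : nat) (A B : finType) (F : {ffun 'I_n -> A * B} -> R) :
  \sum_z F z = \sum_(x : {ffun 'I_n -> A}) \sum_(y : {ffun 'I_n -> B}) F [ffun i => (x i, y i)].
Proof.
pose f (z : {ffun 'I_n -> A * B}) : {ffun 'I_n -> A} * {ffun 'I_n -> B} :=
  ([ffun i => (z i).1], [ffun i => (z i).2]).
rewrite pair_bigA (reindex (fun u : {ffun 'I_n -> A} * {ffun 'I_n -> B} => [ffun i => (u.1 i, u.2 i)])) //=.
exists f => [[a b]|z] _ /=.
  by rewrite /f; congr (_, _); apply/ffunP => i; rewrite !ffunE.
by apply/ffunP => i; rewrite !ffunE -surjective_pairing.
Qed.

End Zip.

Section ConditionalTypicality.
Variables (R : realType) (W : finType) (d : nat) (p : W -> R) (q : W -> 'I_d -> R).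
Hypotheses (dp : distr p) (dq : forall a, distr (q a)).

Definition joint (ab : W * 'I_d) : R := p ab.1 * q ab.1 ab.2.

Lemma joint_distr : distr joint.
Proof.
split=> [[a b]|]; first by rewrite mulr_ge0 ?dp.1 ?(dq a).1.
rewrite -(pair_bigA _ (fun a b => p a * q a b)) /= -dp.2.
by apply: eq_bigr => a _; rewrite -mulr_sumr (dq a).2 mulr1.
Qed.

Section Seq.
Variables (n : nat) (w : {ffun 'I_n -> W}) (s : {ffun 'I_n -> 'I_d}).

Definition zipf : {ffun 'I_n -> W * 'I_d} := [ffun i => (w i, s i)].

Lemma zipfE i : zipf i = (w i, s i). Proof. by rewrite ffunE. Qed.

Lemma Ncount_zip a b : #|[set i | (w i == a) && (s i == b)]| = Ncount (a, b) zipf.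
Proof. by rewrite /Ncount; apply: eq_card => i; rewrite !inE ffunE. Qed.

Lemma Ncount_sum a : (Ncount a w)%:R = \sum_b (Ncount (a, b) zipf)%:R :> R.
Proof.
under eq_bigr do rewrite NcountE.
rewrite NcountE exchange_big /=; apply: eq_bigr => i _.
rewrite (bigD1 (s i)) //= zipfE xpair_eqE eqxx andbT big1 ?addr0 // => b bs.
by rewrite xpair_eqE andbC [s i == b]eq_sym (negPf bs).
Qed.

(** Reduces conditional typicality to ordinary typicality of pairs. Summing over [b] gives the
    marginal with tolerance [delta / 3]. For the conditional frequency, the numerator is off by two
    errors of [delta / 3] times [P Q], while the denominator is at least [2/3 P]; the ratio is
    [delta * Q]. *)
Lemma zip_typical delta : 0 < delta <= 1 -> (0 < n)%N ->
  typical joint (delta / 3) zipf -> typical p delta w && ctyp q delta w s.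
Proof.
move=> /andP[d0 d1] n0 /forallP h; have n0' : 0 < n%:R :> R by rewrite ltr0n.
pose N ab : R := (Ncount ab zipf)%:R / n%:R.
have h' a b : `|N (a, b) - p a * q a b| <= delta / 3 * (p a * q a b) by exact: h (a, b).
have hp a : `|(Ncount a w)%:R / n%:R - p a| <= delta / 3 * p a.
  have -> : delta / 3 * p a = \sum_b delta / 3 * (p a * q a b).
    by rewrite -!mulr_sumr (dq a).2 mulr1.
  have -> : (Ncount a w)%:R / n%:R - p a = \sum_b (N (a, b) - p a * q a b).
    by rewrite sumrB -mulr_sumr (dq a).2 mulr1 -mulr_suml -Ncount_sum.
  by apply: le_trans (ler_norm_sum _ _ _) _; apply: ler_sum => b _; exact: h'.
apply/andP; split.
  apply/forallP => a; apply: le_trans (hp a) _; rewrite ler_wpM2r ?dp.1 //; lra.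
apply/forallP => a; apply/implyP => Na; apply/forallP => b; rewrite Ncount_zip.
have := hp a; have := h' a b; rewrite /N.
have : 0 < (Ncount a w)%:R :> R by rewrite ltr0n.
move: (Ncount a w)%:R (Ncount (a, b) zipf)%:R => y x y0.
have := dp.1 a; have := (dq a).1 b; move: (p a) (q a b) => P Q Q0 P0.
have -> : x / y - Q = (x / n%:R - Q * (y / n%:R)) / (y / n%:R) by field; rewrite !gt_eqF.
have : 0 < y / n%:R by rewrite divr_gt0.
move: (x / _) (y / _) => x' y' {}y0 hx hy; move: y' y0 hy => {}y y0 hy.
rewrite normrM normfV (gtr0_norm y0) ler_pdivrMr //.
have -> : x' - Q * y = (x' - P * Q) - Q * (y - P) by ring.
apply: le_trans (ler_normB _ _) _; rewrite normrM (ger0_norm Q0).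
have e1 : Q * `|y - P| <= Q * (delta / 3 * P) by rewrite ler_wpM2l.
have e2 : P - delta / 3 * P <= y by move: hy; rewrite ler_norml => /andP[]; lra.
have e3 : 2 / 3 * P <= y.
  apply: le_trans e2; have : delta * P <= P by rewrite ler_piMl. lra.
have e4 : delta * Q * (2 / 3 * P) <= delta * Q * y by rewrite ler_wpM2l // mulr_ge0 // ltW.
lra.
Qed.

Lemma ctyp_count delta a b : 0 <= delta -> (0 < n)%N -> ctyp q delta w s ->
  (1 - delta) * q a b * (Ncount a w)%:R <= (Ncount (a, b) zipf)%:R <=
  (1 + delta) * q a b * (Ncount a w)%:R.
Proof.
move=> d0 n0 /forallP/(_ a)/implyP h.
case: (posnP (Ncount a w)) => [N0|N0].
  have : (Ncount (a, b) zipf)%:R <= (Ncount a w)%:R :> R.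
    by rewrite Ncount_sum (bigD1 b) //= lerDl; apply: sumr_ge0.
  by rewrite N0 !mulr0 ler0n => ->.
have := forallP (h N0) b; rewrite Ncount_zip ler_norml => /andP[h1 h2].
have N0' : 0 < (Ncount a w)%:R :> R by rewrite ltr0n.
by apply/andP; split; [rewrite -ler_pdivlMr // | rewrite -ler_pdivrMr //]; lra.
Qed.

Lemma typical_count delta a : (0 < n)%N -> typical p delta w ->
  (1 - delta) * p a * n%:R <= (Ncount a w)%:R <= (1 + delta) * p a * n%:R.
Proof.
move=> n0 /forallP/(_ a); rewrite ler_norml => /andP[h1 h2].
have n0' : 0 < n%:R :> R by rewrite ltr0n.
by apply/andP; split; [rewrite -ler_pdivlMr // | rewrite -ler_pdivrMr //]; lra.
Qed.

(** The tolerance is relative to [q], so a symbol of conditional probability zero has no slack and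
    cannot occur. This permits taking logarithms in [prod_expR]. *)
Lemma ctyp_pos delta i : 0 <= delta -> ctyp q delta w s -> 0 < q (w i) (s i).
Proof.
move=> d0 /forallP/(_ (w i))/implyP h; rewrite lt0r (dq _).1 andbT; apply/eqP => q0.
have N0 : (0 < Ncount (w i) w)%N by rewrite card_gt0; apply/set0Pn; exists i; rewrite inE.
have := forallP (h N0) (s i); rewrite q0 mulr0 normr_le0 subr0 mulf_eq0 invr_eq0.
rewrite !pnatr_eq0 (gtn_eqF N0) orbF cards_eq0 => /eqP/setP/(_ i).
by rewrite !inE !eqxx.
Qed.

End Seq.

(** Measured in nats to fit [expR]; the conversion to bits divides by [ln 2]. *)
Definition nat_entropy (r : 'I_d -> R) : R := \sum_b - (r b * ln (r b)).
Definition cond_entropy : R := \sum_a p a * nat_entropy (q a).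


Section Bounds.
Variables (n : nat) (w : {ffun 'I_n -> W}) (s : {ffun 'I_n -> 'I_d}) (d1 d2 : R).
Hypotheses (n0 : (0 < n)%N) (d10 : 0 <= d1 < 1) (d20 : 0 <= d2 < 1)
  (tw : typical p d1 w) (ts : ctyp q d2 w s).

(** Grouping positions by letter and symbol leaves only empirical counts, which is what typicality
    controls. *)
Lemma prod_expR : \prod_i q (w i) (s i) =
  expR (- \sum_a \sum_b (Ncount (a, b) (zipf w s))%:R * - ln (q a b)).
Proof.
have d20' : 0 <= d2 by case/andP: d20.
transitivity (expR (\sum_i ln (q (w i) (s i)))).
  rewrite expR_sum; apply: eq_bigr => i _; rewrite lnK // posrE; exact: ctyp_pos d20' ts.
congr expR; rewrite -sumrN.
under [RHS]eq_bigr => a _.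
  rewrite -sumrN; under eq_bigr => b _ do rewrite mulrN opprK NcountE mulr_suml.
  over.
rewrite pair_big exchange_big /=; apply: eq_bigr => i _.
rewrite (bigD1 (w i, s i)) //= zipfE eqxx mul1r big1 ?addr0 // => -[a b] /negPf.
by rewrite eq_sym => -> /=; rewrite mul0r.
Qed.

Lemma ln_q_le0 a b : 0 <= - ln (q a b).
Proof.
rewrite oppr_ge0; apply: ln_le0; exact: distr_le1 (dq a) b.
Qed.

Lemma cond_entropyE c : c * n%:R * cond_entropy =
  \sum_a \sum_b (c * q a b * (p a * n%:R)) * - ln (q a b).
Proof.
rewrite /cond_entropy mulr_sumr; apply: eq_bigr => a _.
rewrite /nat_entropy mulrA mulr_sumr; apply: eq_bigr => b _; ring.
Qed.

(** As [- ln q] is nonnegative, counts may be bounded termwise: [1 - d2] comes from the frequency of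
    [b] among the positions of [a], and [1 - d1] from the frequency of [a]. *)
Lemma typ_prob_le : \prod_i q (w i) (s i) <= expR (- ((1 - d1) * (1 - d2) * n%:R * cond_entropy)).
Proof.
rewrite prod_expR ler_expR lerN2 cond_entropyE; apply: ler_sum => a _; apply: ler_sum => b _.
rewrite ler_wpM2r ?ln_q_le0 //.
case/andP: d20 => d20' d21; case/andP: d10 => d10' d11.
have /andP[h1 _] := ctyp_count a b d20' n0 ts.
have /andP[h2 _] := typical_count a n0 tw.
apply: le_trans h1; have qd : 0 <= (1 - d2) * q a b by rewrite mulr_ge0 ?(dq a).1 // subr_ge0 ltW.
have := ler_wpM2l qd h2; apply: le_trans; rewrite le_eqVlt; apply/orP; left; apply/eqP; ring.
Qed.

Lemma typ_prob_ge : expR (- ((1 + d1) * (1 + d2) * n%:R * cond_entropy)) <= \prod_i q (w i) (s i).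
Proof.
rewrite prod_expR ler_expR lerN2 cond_entropyE; apply: ler_sum => a _; apply: ler_sum => b _.
rewrite ler_wpM2r ?ln_q_le0 //.
case/andP: d20 => d20' d21; case/andP: d10 => d10' d11.
have /andP[_ h1] := ctyp_count a b d20' n0 ts.
have /andP[_ h2] := typical_count a n0 tw.
apply: le_trans h1 _; have qd : 0 <= (1 + d2) * q a b by rewrite mulr_ge0 ?(dq a).1 // addr_ge0.
have := ler_wpM2l qd h2; move/le_trans; apply; rewrite le_eqVlt; apply/orP; left; apply/eqP; ring.
Qed.

End Bounds.

Lemma cond_lln (delta : R) : 0 < delta <= 1 -> exists2 K : R, 0 <= K &
  forall n, (0 < n)%N ->
  \sum_(w : {ffun 'I_n -> W}) \prod_i p (w i) *
   (\sum_(s : {ffun 'I_n -> 'I_d}) \prod_i q (w i) (s i) *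
      (~~ (typical p delta w && ctyp q delta w s))%:R) <= K / n%:R.
Proof.
move=> dd; have [d0 _] := andP dd.
have [|K K0 hK] := typical_lln joint_distr (delta := delta / 3); first by rewrite divr_gt0.
exists K => // n n0; apply: le_trans (hK n n0).
rewrite [leRHS]big_zip; apply: ler_sum => w _; rewrite mulr_sumr; apply: ler_sum => s _.
rewrite -/(zipf w s); have -> : \prod_i joint (zipf w s i) = \prod_i p (w i) * \prod_i q (w i) (s i).
  by rewrite -big_split; apply: eq_bigr => i _; rewrite zipfE.
rewrite mulrA ler_wpM2l //.
  by rewrite mulr_ge0 //; apply: prodr_ge0 => i _; rewrite ?dp.1 ?(dq _).1.
rewrite ler_nat; case: (boolP (typical joint (delta / 3) (zipf w s))) => [h|]; last by case: (_ && _).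
by rewrite (zip_typical dd n0 h).
Qed.

End ConditionalTypicality.

(** * Entropies of the channel *)

Section Entropy.
Variable R : realType.
Local Notation C := R[i].

Definition plog (r : R) : R := - (r * log2 r).

Lemma entropy_eigdec n (A U : 'M[C]_n) q : eigdec A U q -> entropy A = \sum_i plog (q i).
Proof.
move=> e; rewrite /entropy (perm_big _ (eigvals_eigdec e)) big_map big_enum /=. by [].
Qed.

Lemma entropy_fmx (K : finType) (f u : K -> K -> C) (q : K -> R) :
  (forall k l, \sum_j u k j * conjc (u l j) = (k == l)%:R) ->
  (forall k l, \sum_j conjc (u j k) * u j l = (k == l)%:R) ->
  (forall k l, f k l = \sum_j u k j * toC (q j) * conjc (u l j)) ->
  entropy (fmx f) = \sum_k plog (q k).
Proof.
move=> u1 u2 fE; rewrite -(big_enum_val_all (fun k => plog (q k))).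
apply: (@entropy_eigdec _ _ (fmx u)); split.
  by rewrite mxH_fmx fmxM -fmx1; exact: eq_fmx.
split; first by rewrite mxH_fmx fmxM -fmx1; exact: eq_fmx.
rewrite -/(dg _) -(fmx_dg q) mxH_fmx !fmxM; apply: eq_fmx => k l; rewrite fE.
apply: eq_bigr => j _; congr (_ * _).
rewrite (bigD1 j) //= eqxx mulr1n big1 ?addr0 // => i /negPf ->.
by rewrite mulr0n mulr0.
Qed.

Lemma entropy_diag (K : finType) (q : K -> R) :
  entropy (fmx (fun k l => toC (q k) *+ (k == l))) = \sum_k plog (q k).
Proof.
have d1 (k l : K) (g : K -> C) : \sum_j (k == j)%:R * g j = g k.
  by rewrite (bigD1 k) //= eqxx mul1r big1 ?addr0 // => j /negPf jk; rewrite eq_sym jk mul0r.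
apply: (@entropy_fmx _ _ (fun k l => (k == l)%:R)) => k l.
- by rewrite d1 // rmorph_nat eq_sym.
- under eq_bigr do rewrite rmorph_nat eq_sym; by rewrite d1.
- under eq_bigr do rewrite rmorph_nat -mulrA; by rewrite d1 // eq_sym mulr_natr.
Qed.

(** The block-diagonal unitary assembled from the [U a] diagonalises the state, with eigenvalues
    [p a * q a b]. *)
Lemma entropy_block (T : finType) d (p : T -> R) (sigma U : T -> 'M[C]_d) q :
  (forall a, eigdec (sigma a) (U a) (q a)) ->
  entropy (fmx (fun k l : T * 'I_d => if k.1 == l.1 then toC (p k.1) * sigma k.1 k.2 l.2 else 0)) =
  \sum_a \sum_b plog (p a * q a b).
Proof.
move=> dec; rewrite pair_bigA.
have blk (a : T) (g : T -> 'I_d -> C) :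
    \sum_(j : T * 'I_d) (if a == j.1 then g j.1 j.2 else 0) = \sum_b g a b.
  rewrite -(pair_bigA _ (fun c b => if a == c then g c b else 0)) (bigD1 a) //= eqxx.
  rewrite [X in _ + X]big1 ?addr0 // => c /negPf ca.
  by rewrite big1 // => b _; rewrite eq_sym ca.
apply: (@entropy_fmx _ _ (fun k l => if k.1 == l.1 then U k.1 k.2 l.2 else 0)) => -[a b] [c e] /=.
- transitivity (\sum_(j : T * 'I_d) if a == j.1 then U a b j.2 * conjc (if c == j.1 then U c e j.2 else 0) else 0).
    by apply: eq_bigr => j _; case: ifP => // _; rewrite mul0r.
  rewrite (blk a (fun j1 j2 => U a b j2 * conjc (if c == j1 then U c e j2 else 0))).
  rewrite xpair_eqE; have [<-|ac] := eqVneq a c.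
    have [u1 _] := dec a; have := congr1 (fun M : 'M_d => M b e) u1; rewrite !mxE => <-.
    by apply: eq_bigr => j _; rewrite !mxE.
  by rewrite big1 // => j _; rewrite rmorph0 mulr0.
- transitivity (\sum_(j : T * 'I_d) if a == j.1 then conjc (U j.1 j.2 b) * (if j.1 == c then U j.1 j.2 e else 0) else 0).
    apply: eq_bigr => j _; rewrite [a == _]eq_sym; case: ifP => // _; by rewrite rmorph0 mul0r.
  rewrite (blk a (fun j1 j2 => conjc (U j1 j2 b) * (if j1 == c then U j1 j2 e else 0))).
  rewrite xpair_eqE; have [_|_] := eqVneq a c.
    have [_ [u1 _]] := dec a; have := congr1 (fun M : 'M_d => M b e) u1; rewrite !mxE => <-.
    by apply: eq_bigr => j _; rewrite !mxE.
  by rewrite big1 // => j _; rewrite mulr0.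
- transitivity (\sum_(j : T * 'I_d) if a == j.1 then U a b j.2 * toC (p j.1 * q j.1 j.2) * conjc (if c == j.1 then U c e j.2 else 0) else 0); last first.
    by apply: eq_bigr => j _; case: ifP => // _; rewrite !mul0r.
  rewrite (blk a (fun j1 j2 => U a b j2 * toC (p j1 * q j1 j2) * conjc (if c == j1 then U c e j2 else 0))).
  have [<-|ac] := eqVneq a c.
    have [_ [_ {1}->]] := dec a; rewrite !mxE mulr_sumr; apply: eq_bigr => j _.
    by rewrite mul_mx_diag !mxE toCM; ring.
  by rewrite big1 // => j _; rewrite rmorph0 mulr0.
Qed.

(** An explicit inverse [j] of [(keep, drop)] collapses the guarded double sum to the usual diagonal
    sum over the traced system. *)
Lemma ptraceE (T K D : finType) (keep : T -> K) (drop : T -> D) (j : K -> D -> T) rho :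
  (forall k e, keep (j k e) = k) -> (forall k e, drop (j k e) = e) ->
  (forall t, j (keep t) (drop t) = t) ->
  ptrace keep drop rho = fmx (fun k k' => \sum_e rho (j k e) (j k' e)) :> 'M[C]_#|K|.
Proof.
move=> kj dj jj; apply: eq_fmx => k k'.
transitivity (\sum_t if keep t == k then rho t (j k' (drop t)) else 0).
  apply: eq_bigr => t _; case: ifP => [kt|kt]; last by rewrite big1.
  rewrite (bigD1 (j k' (drop t))) //= kj dj !eqxx big1 ?addr0 // => t' tt'.
  case: eqP => //= kt'; case: eqP => //= dt'.
  by move: tt'; rewrite -kt' dt' jj eqxx.
rewrite (reindex (fun u : K * D => j u.1 u.2)) /=; last first.
  by exists (fun t => (keep t, drop t)) => [[a b]|t] _ /=; rewrite ?kj ?dj ?jj.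
rewrite -(pair_bigA _ (fun a e => if keep (j a e) == k then rho (j a e) (j k' (drop (j a e))) else 0)) /=.
rewrite (bigD1 k) //= [X in _ + X]big1 ?addr0.
  by apply: eq_bigr => e _; rewrite kj dj eqxx.
by move=> a ak; rewrite big1 // => e _; rewrite kj (negPf ak).
Qed.

(** The chain rule for entropy, weight by weight. Zero weights are treated apart because splitting
    the logarithm of a product needs positive factors. *)
Lemma plog_chain d (p : R) (q : 'I_d -> R) : 0 <= p -> distr q ->
  \sum_b plog (p * q b) = plog p + p * (nat_entropy q / ln 2).
Proof.
move=> p0 [q0 q1].
have e b : plog (p * q b) = q b * plog p + p * (- (q b * ln (q b)) / ln 2).
  rewrite /plog /log2; have [->|pn] := eqVneq p 0; first by rewrite !(mul0r, oppr0, mulr0, addr0).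
  have [->|qn] := eqVneq (q b) 0; first by rewrite !(mul0r, oppr0, mulr0, addr0).
  rewrite lnM ?posrE ?lt0r ?pn ?qn ?p0 ?q0 //; ring.
under eq_bigr do rewrite e.
by rewrite big_split /= -mulr_suml q1 mul1r -mulr_sumr -mulr_suml.
Qed.

End Entropy.

Section Informations.
Variables (R : realType) (X Y : finType) (d : nat) (rho : X -> Y -> 'M[R[i]]_d)
  (pX : X -> R) (pY : Y -> R).
Local Notation C := R[i].

Definition rhoX (x : X) : 'M[C]_d := \sum_y toC (pY y) *: rho x y.
Definition rhoB : 'M[C]_d := \sum_x toC (pX x) *: rhoX x.

Variables (U : X -> Y -> 'M[C]_d) (lam : X -> Y -> 'I_d -> R)
  (V : Y -> 'M[C]_d) (mu : Y -> 'I_d -> R)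
  (VX : X -> 'M[C]_d) (nu : X -> 'I_d -> R) (VB : 'M[C]_d) (kap : 'I_d -> R).
Hypotheses (hrho : forall x y, density (rho x y)) (hX : distr pX) (hY : distr pY)
  (dU : forall x y, eigdec (rho x y) (U x y) (lam x y))
  (dV : forall y, eigdec (rhoY rho pX y) (V y) (mu y))
  (dVX : forall x, eigdec (rhoX x) (VX x) (nu x))
  (dVB : eigdec rhoB VB kap).

Lemma eigdec_tr n (A W : 'M[C]_n) q : eigdec A W q -> \tr A = toC (\sum_i q i).
Proof.
move=> [_ [u ->]]; rewrite mxtrace_mulC mulmxA u mul1mx mxtrace_diag toC_sum.
by apply: eq_bigr => i _; rewrite mxE.
Qed.

Lemma psdmx_eig n (A W : 'M[C]_n) q i : psdmx A -> eigdec A W q -> 0 <= q i.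
Proof.
move=> [_ psd] [_ [u2 AE]]; have := psd (col i W).
have e : mxH (col i W) *m W = delta_mx 0 i.
  have -> : mxH (col i W) = row i (mxH W) by apply/rowP => j; rewrite !mxE.
  by rewrite -row_mul u2 row1.
have e' : mxH W *m col i W = delta_mx i 0 by rewrite colE mulmxA u2 mul1mx.
rewrite AE !mulmxA e -mulmxA e' -rowE mxE big_mkcond /= (bigD1 i) //= !mxE eqxx mulr1n mulr1.
rewrite big1 => [|j /negPf ji]; last by rewrite !mxE ji mulr0.
by rewrite addr0 toCE ler0c.
Qed.

Lemma density_distr n (A W : 'M[C]_n) q : density A -> eigdec A W q -> distr q.
Proof.
move=> [psd tr1] dec; split=> [i|]; first exact: psdmx_eig psd dec.
by have := eigdec_tr dec; rewrite tr1 => -[].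
Qed.

Lemma density_mix (T : finType) n (p : T -> R) (A : T -> 'M[C]_n) : distr p ->
  (forall t, density (A t)) -> density (\sum_t toC (p t) *: A t).
Proof.
move=> [p0 p1] dA; split.
  split.
    have -> : mxH (\sum_t toC (p t) *: A t) = \sum_t mxH (toC (p t) *: A t).
      by apply: big_morph; [exact: mxHD | exact: mxH0].
    by apply: eq_bigr => t _; rewrite mxHZ -(dA t).1.1.
  move=> v; rewrite mulmx_sumr mulmx_suml summxE; apply: sumr_ge0 => t _.
  by rewrite -scalemxAr -scalemxAl mxE mulr_ge0 ?(dA t).1.2 // toCE ler0c.
rewrite raddf_sum /=; under eq_bigr do rewrite mxtraceZ (dA _).2 mulr1.
by rewrite -toC_sum p1.
Qed.

Lemma rhoX_density x : density (rhoX x). Proof. exact: density_mix. Qed.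
Lemma rhoY_density y : density (rhoY rho pX y).
Proof. by apply: density_mix. Qed.
Lemma rhoB_density : density rhoB.
Proof. by apply: density_mix => //; exact: rhoX_density. Qed.

Local Notation pw := (pXY pX pY).
Local Notation h := (fun q : 'I_d -> R => nat_entropy q / ln 2).

Lemma S_XYB_eq : S_XYB rho pX pY =
  \sum_(w : X * Y) plog (pw w) + cond_entropy pw (fun w => lam w.1 w.2) / ln 2.
Proof.
rewrite /S_XYB; have := @entropy_block R (X * Y)%type d pw (fun w => rho w.1 w.2) (fun w => U w.1 w.2)
  (fun w => lam w.1 w.2) (fun w => dU w.1 w.2); rewrite /rhoXYB => ->.
rewrite /cond_entropy mulr_suml -big_split; apply: eq_bigr => -[x y] _ /=.
rewrite plog_chain ?mulrA //; first by rewrite mulr_ge0 ?hX.1 ?hY.1.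
exact: density_distr (hrho x y) (dU x y).
Qed.

Lemma S_XY_eq : S_XY rho pX pY = \sum_(w : X * Y) plog (pw w).
Proof.
rewrite -entropy_diag /S_XY (ptraceE (j := fun k b => (k, b))); [|by []|by []|by case].
congr entropy; apply: eq_fmx => -[x y] k' /=; rewrite /rhoXYB /=.
case: eqP => [_|_] /=; last by rewrite big1.
by rewrite -mulr_sumr -/(\tr _) (hrho x y).2 mulr1.
Qed.

Lemma S_X_eq : S_X rho pX pY = \sum_x plog (pX x).
Proof.
rewrite -entropy_diag /S_X (ptraceE (j := fun x (e : Y * 'I_d) => ((x, e.1), e.2))); [|by []|by move=> ? []|by case=> -[]].
congr entropy; apply: eq_fmx => x x' /=.
rewrite -(pair_bigA _ (fun y b => rhoXYB rho pX pY ((x, y), b) ((x', y), b))) /=.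
rewrite /rhoXYB /=; have [<-|xx] := eqVneq x x'.
  under eq_bigr => y _.
    under eq_bigr do rewrite !eqxx.
    rewrite -mulr_sumr -/(\tr _) (hrho x y).2 mulr1 toCM.
    over.
  by rewrite -mulr_sumr -toC_sum hY.2 mulr1.
by rewrite big1 // => y _; rewrite big1 // => b _; rewrite xpair_eqE (negPf xx).
Qed.

Lemma S_Y_eq : S_Y rho pX pY = \sum_y plog (pY y).
Proof.
rewrite -entropy_diag /S_Y (ptraceE (j := fun y (e : X * 'I_d) => ((e.1, y), e.2))); [|by []|by move=> ? []|by case=> -[]].
congr entropy; apply: eq_fmx => y y' /=.
rewrite -(pair_bigA _ (fun x b => rhoXYB rho pX pY ((x, y), b) ((x, y'), b))) /=.
rewrite /rhoXYB /=; have [<-|yy] := eqVneq y y'.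
  under eq_bigr => x _.
    under eq_bigr do rewrite !eqxx.
    rewrite -mulr_sumr -/(\tr _) (hrho x y).2 mulr1 toCM mulrC.
    over.
  by rewrite -mulr_sumr -toC_sum hX.2 mulr1.
by rewrite big1 // => x _; rewrite big1 // => b _; rewrite xpair_eqE (negPf yy) andbF.
Qed.

Lemma S_YB_eq : S_YB rho pX pY = \sum_y plog (pY y) + cond_entropy pY mu / ln 2.
Proof.
rewrite /S_YB (ptraceE (j := fun (k : Y * 'I_d) x => ((x, k.1), k.2))); [|by case|by []|by case=> -[]].
transitivity (\sum_y \sum_b plog (pY y * mu y b)).
  rewrite -(entropy_block pY dV); congr entropy; apply: eq_fmx => -[y b] [y' b'] /=.
  rewrite /rhoXYB /=; have [<-|yy] := eqVneq y y'; last first.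
    by rewrite big1 // => x _; rewrite xpair_eqE (negPf yy) andbF.
  rewrite /rhoY summxE mulr_sumr; apply: eq_bigr => x _.
  by rewrite eqxx mxE toCM; ring.
rewrite /cond_entropy mulr_suml -big_split; apply: eq_bigr => y _ /=.
rewrite plog_chain ?mulrA //; first exact: hY.1.
exact: density_distr (rhoY_density y) (dV y).
Qed.

Lemma S_XB_eq : S_XB rho pX pY = \sum_x plog (pX x) + cond_entropy pX nu / ln 2.
Proof.
rewrite /S_XB (ptraceE (j := fun (k : X * 'I_d) y => ((k.1, y), k.2))); [|by case|by []|by case=> -[]].
transitivity (\sum_x \sum_b plog (pX x * nu x b)).
  rewrite -(entropy_block pX dVX); congr entropy; apply: eq_fmx => -[x b] [x' b'] /=.
  rewrite /rhoXYB /=; have [<-|xx] := eqVneq x x'; last first.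
    by rewrite big1 // => y _; rewrite xpair_eqE (negPf xx).
  rewrite /rhoX summxE mulr_sumr; apply: eq_bigr => y _.
  by rewrite eqxx mxE toCM; ring.
rewrite /cond_entropy mulr_suml -big_split; apply: eq_bigr => x _ /=.
rewrite plog_chain ?mulrA //; first exact: hX.1.
exact: density_distr (rhoX_density x) (dVX x).
Qed.

Lemma S_B_eq : S_B rho pX pY = nat_entropy kap / ln 2.
Proof.
rewrite /S_B (ptraceE (j := fun (k : 'I_d) w => (w, k))); [|by []|by []|by case].
have [u1 [u2 rE]] := dVB.
transitivity (\sum_b plog (kap b)).
  apply: (@entropy_fmx _ _ _ (fun k l => VB k l)) => k l.
  - have := congr1 (fun M : 'M_d => M k l) u1; rewrite !mxE => <-.
    by apply: eq_bigr => j _; rewrite !mxE.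
  - have := congr1 (fun M : 'M_d => M k l) u2; rewrite !mxE => <-.
    by apply: eq_bigr => j _; rewrite !mxE.
  have := congr1 (fun M : 'M_d => M k l) rE; rewrite !mxE => e.
  transitivity (rhoB k l).
    rewrite /rhoB summxE; rewrite -(pair_bigA _ (fun x y => rhoXYB rho pX pY ((x, y), k) ((x, y), l))) /=.
    apply: eq_bigr => x _; rewrite mxE /rhoX summxE mulr_sumr; apply: eq_bigr => y _.
    by rewrite /rhoXYB eqxx mxE toCM mulrA.
  by rewrite e; apply: eq_bigr => j _; rewrite mul_mx_diag !mxE.
rewrite /nat_entropy mulr_suml; apply: eq_bigr => b _.
by rewrite /plog /log2 mulrA mulNr.
Qed.

(** The entropies of the classical registers cancel, leaving the average entropies of the
    conditional states. *)
Lemma I_X_B_given_Y_eq : I_X_B_given_Y rho pX pY =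
  (cond_entropy pY mu - cond_entropy pw (fun w => lam w.1 w.2)) / ln 2.
Proof. rewrite /I_X_B_given_Y S_XY_eq S_YB_eq S_XYB_eq S_Y_eq; ring. Qed.

Lemma I_Y_B_given_X_eq : I_Y_B_given_X rho pX pY =
  (cond_entropy pX nu - cond_entropy pw (fun w => lam w.1 w.2)) / ln 2.
Proof. rewrite /I_Y_B_given_X S_XY_eq S_XB_eq S_XYB_eq S_X_eq; ring. Qed.

Lemma I_XY_B_eq : I_XY_B rho pX pY =
  (nat_entropy kap - cond_entropy pw (fun w => lam w.1 w.2)) / ln 2.
Proof. rewrite /I_XY_B S_XY_eq S_B_eq S_XYB_eq; ring. Qed.

End Informations.

(** * Typical projectors *)

Section TypicalProjector.
Variables (R : realType) (W : finType) (n d : nat) (p : W -> R).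
Variables (sigma U : W -> 'M[R[i]]_d) (q : W -> 'I_d -> R).
Hypotheses (dq : forall a, distr (q a)) (n0 : (0 < n)%N).
Hypothesis dec : forall a, eigdec (sigma a) (U a) (q a).
Implicit Types w : {ffun 'I_n -> W}.
Local Notation H := (cond_entropy p q).
Local Notation tens w := (tensn (fun i => sigma (w i))).

(** Vanishes on atypical [w], so that the bounds below hold for every [w]. *)
Definition tproj d1 d2 w : 'M[R[i]]_(nsys n d) :=
  if typical p d1 w then condtyp_proj U q d2 w else 0.

Lemma tprojE d1 d2 w : tproj d1 d2 w =
  sw (tU U w) (fun k => (typical p d1 w && ctyp q d2 w (enum_val k))%:R).
Proof.
rewrite /tproj (condtyp_projE U); case: (typical _ _ _) => //=.
by rewrite /sw (_ : dg _ = 0) ?mulmx0 ?mul0mx //; apply/matrixP => i j; rewrite !mxE mul0rn.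
Qed.

Let unit2 w := (tU_unitary dec w).2.
Let unit1 w := (tU_unitary dec w).1.

Lemma isproj_tproj d1 d2 w : isproj (tproj d1 d2 w).
Proof. by rewrite tprojE; apply: isproj_sw (unit2 w) _. Qed.

Lemma tq_ge0 w k : 0 <= tq q w k.
Proof. by apply: prodr_ge0 => i _; rewrite (dq _).1. Qed.

Lemma tproj_sandwich d1 d2 w : tproj d1 d2 w *m tens w *m tproj d1 d2 w =
  sw (tU U w) (fun k => tq q w k * (typical p d1 w && ctyp q d2 w (enum_val k))%:R).
Proof.
rewrite tprojE (tensn_eig dec) !(swM (unit2 w)); apply: eq_sw => k.
by case: (_ && _); rewrite /= ?mul1r ?mulr1 // !mul0r mulr0.
Qed.

Lemma tproj_sandwich_le d1 d2 w : lop (tproj d1 d2 w *m tens w *m tproj d1 d2 w) (tens w).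
Proof.
rewrite tproj_sandwich (tensn_eig dec); apply: lop_sw => k.
by case: (_ && _); rewrite /= ?mulr1 // mulr0 tq_ge0.
Qed.

Lemma scalar_sw w r : toC r *: 1%:M = sw (tU U w) (fun=> r * 1).
Proof. by rewrite swZ sw1. Qed.

Lemma tproj_flat d1 d2 w : 0 <= d1 < 1 -> 0 <= d2 < 1 ->
  lop (tproj d1 d2 w *m tens w *m tproj d1 d2 w)
      (toC (expR (- ((1 - d1) * (1 - d2) * n%:R * H))) *: 1%:M).
Proof.
move=> h1 h2; rewrite tproj_sandwich (scalar_sw w); apply: lop_sw => k; rewrite mulr1.
case: (boolP (_ && _)) => [/andP[t1 t2]|_]; last by rewrite mulr0 expR_ge0.
by rewrite mulr1; exact: (typ_prob_le dq n0 h1 h2 t1 t2).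
Qed.

Lemma tproj_ge d1 d2 w : 0 <= d1 < 1 -> 0 <= d2 < 1 ->
  lop (tproj d1 d2 w) (toC (expR ((1 + d1) * (1 + d2) * n%:R * H)) *: tens w).
Proof.
move=> h1 h2; rewrite tprojE (tensn_eig dec) -swZ; apply: lop_sw => k.
case: (boolP (_ && _)) => [/andP[t1 t2]|_]; last by rewrite mulr_ge0 ?expR_ge0 ?tq_ge0.
have := typ_prob_ge dq n0 h1 h2 t1 t2; rewrite expRN -[leRHS]mul1r => h.
by rewrite -ler_pdivrMl ?expR_gt0 // mulr1; move: h; rewrite mul1r.
Qed.

Lemma rtr_tens w : rtr (tens w) = 1.
Proof.
rewrite (tensn_eig dec) (rtr_sw (unit2 w)) (big_enum_val_all (fun s : {ffun 'I_n -> 'I_d} => \prod_i q (w i) (s i))).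
have := bigA_distr_bigA (fun i b => q (w i) b) => <-.
by rewrite big1 // => i _; rewrite (dq _).2.
Qed.

(** State and projector share an eigenbasis, so the quantum loss is the probability that a classical
    eigenvalue sequence is atypical, the quantity bounded by [cond_lln]. *)
Lemma tproj_loss d1 d2 w : rtr ((1%:M - tproj d1 d2 w) *m tens w) =
  \sum_(s : {ffun 'I_n -> 'I_d}) \prod_i q (w i) (s i) * (~~ (typical p d1 w && ctyp q d2 w s))%:R.
Proof.
rewrite tprojE (tensn_eig dec) -(sw1 (unit1 w)) -swB (swM (unit2 w)) (rtr_sw (unit2 w)).
rewrite -(big_enum_val_all (fun s : {ffun 'I_n -> 'I_d} => \prod_i q (w i) (s i) * (~~ (typical p d1 w && ctyp q d2 w s))%:R)).
by apply: eq_bigr => k _; rewrite mulrC /tq; case: (_ && _); rewrite /= ?subrr ?subr0.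
Qed.

(** The Hermitian square root of the product state, used as the vector-like [S]: for a projector
    [P], the quantity [hs (P *m tsqrt w)] is the acceptance probability. *)
Definition tsqrt w := sw (tU U w) (fun k => Num.sqrt (tq q w k)).

Lemma tsqrtK w : tsqrt w *m mxH (tsqrt w) = tens w.
Proof.
rewrite /tsqrt mxH_sw (swM (unit2 w)) (tensn_eig dec); apply: eq_sw => k.
by rewrite -expr2 sqr_sqrtr ?tq_ge0.
Qed.

End TypicalProjector.

Section Misc.
Variable R : realType.

Lemma hs_rtr n m (P : 'M[R[i]]_n) (S : 'M[R[i]]_(n, m)) : isproj P ->
  hs (P *m S) = rtr (P *m (S *m mxH S)).
Proof. by move=> pP; rewrite (hs_proj pP) /ip rtr_mulC mulmxA. Qed.

Lemma hs_rtr2 n m k (M : 'M[R[i]]_(k, n)) (S : 'M[R[i]]_(n, m)) :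
  hs (M *m S) = rtr ((mxH M *m M) *m (S *m mxH S)).
Proof. by rewrite /hs /ip mxHM -mulmxA rtr_mulC !mulmxA. Qed.

Lemma avg_rtr (n d : nat) (T : finType) (p : T -> R) (F : 'I_n -> T -> 'M[R[i]]_d) M :
  \sum_(w : {ffun 'I_n -> T}) \prod_i p (w i) * rtr (M *m tensn (fun i => F i (w i))) =
  rtr (M *m tensn (fun i => \sum_t toC (p t) *: F i t)).
Proof.
rewrite -tensn_avg mulmx_sumr rtr_sum; apply: eq_bigr => w _.
by rewrite -scalemxAr rtrZ.
Qed.

(** Summing the relative tolerances over the first component preserves [delta]. Hence an atypical
    [y] makes every pair atypical, and no test with that [y] can accept. *)
Lemma typical_snd n (X Y : finType) (pX : X -> R) (pY : Y -> R) delta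
   (x : {ffun 'I_n -> X}) (y : {ffun 'I_n -> Y}) : distr pX ->
  typical (pXY pX pY) delta [ffun i => (x i, y i)] -> typical pY delta y.
Proof.
move=> hX /forallP h; apply/forallP => b.
pose N ab : R := (Ncount ab ([ffun i => (x i, y i)] : {ffun 'I_n -> X * Y}))%:R / n%:R.
have -> : delta * pY b = \sum_a delta * pXY pX pY (a, b).
  by rewrite /pXY /= -mulr_sumr -mulr_suml hX.2 mul1r.
have -> : (Ncount b y)%:R / n%:R - pY b = \sum_a (N (a, b) - pXY pX pY (a, b)).
  rewrite sumrB /pXY /= -[X in _ = _ - X]mulr_suml hX.2 mul1r -mulr_suml; congr (_ / _ - _).
  under [RHS]eq_bigr do rewrite NcountE.
  rewrite NcountE exchange_big /=; apply: eq_bigr => i _.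
  rewrite (bigD1 (x i)) //= ffunE xpair_eqE eqxx /= big1 ?addr0 // => a ax.
  by rewrite xpair_eqE eq_sym (negPf ax).
by apply: le_trans (ler_norm_sum _ _ _) _; apply: ler_sum => a _; exact: h.
Qed.

End Misc.

(** * Error terms of the decoder *)

Lemma cond_entropy_unit (R : realType) d (kap : 'I_d -> R) :
  cond_entropy (fun _ : unit => 1) (fun=> kap) = nat_entropy kap.
Proof.
by rewrite /cond_entropy (bigD1 tt) //= big1 ?addr0 ?mul1r // => -[].
Qed.

Lemma pXY_distr (R : realType) (X Y : finType) (pX : X -> R) (pY : Y -> R) :
  distr pX -> distr pY -> distr (pXY pX pY).
Proof.
move=> hX hY; split=> [[x y]|]; first by rewrite mulr_ge0 ?hX.1 ?hY.1.
rewrite -(pair_bigA _ (fun x y => pX x * pY y)) /= -[RHS]hX.2.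
by apply: eq_bigr => x _; rewrite -mulr_sumr hY.2 mulr1.
Qed.

Section MAC.
Variables (R : realType) (X Y : finType) (d : nat) (rho : X -> Y -> 'M[R[i]]_d)
  (pX : X -> R) (pY : Y -> R).
Local Notation C := R[i].
Variables (U : X -> Y -> 'M[C]_d) (lam : X -> Y -> 'I_d -> R)
  (V : Y -> 'M[C]_d) (mu : Y -> 'I_d -> R)
  (VX : X -> 'M[C]_d) (nu : X -> 'I_d -> R) (VB : 'M[C]_d) (kap : 'I_d -> R).
Hypotheses (hrho : forall x y, density (rho x y)) (hX : distr pX) (hY : distr pY)
  (dU : forall x y, eigdec (rho x y) (U x y) (lam x y))
  (dV : forall y, eigdec (rhoY rho pX y) (V y) (mu y))
  (dVX : forall x, eigdec (rhoX rho pY x) (VX x) (nu x))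
  (dVB : eigdec (rhoB rho pX pY) VB kap).

Local Notation pw := (pXY pX pY).
Local Notation rho2 := (fun w : X * Y => rho w.1 w.2).
Local Notation U2 := (fun w : X * Y => U w.1 w.2).
Local Notation lam2 := (fun w : X * Y => lam w.1 w.2).
Local Notation H_XY := (cond_entropy pw lam2).
Local Notation H_X := (cond_entropy pX nu).
Local Notation H_Y := (cond_entropy pY mu).
Local Notation H_B := (nat_entropy kap).

Let dw : distr pw. Proof. exact: pXY_distr. Qed.
Let dU2 (w : X * Y) : eigdec (rho2 w) (U2 w) (lam2 w). Proof. exact: dU. Qed.
Let lam_distr (w : X * Y) : distr (lam2 w).
Proof. exact: density_distr (hrho _ _) (dU _ _). Qed.
Let mu_distr y : distr (mu y).
Proof. exact: density_distr (rhoY_density hrho hX y) (dV y). Qed.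
Let nu_distr x : distr (nu x).
Proof. exact: density_distr (rhoX_density hrho hY x) (dVX x). Qed.
Let kap_distr : distr kap.
Proof. exact: density_distr (rhoB_density hrho hX hY) dVB. Qed.
Let d1 : distr (fun _ : unit => 1 : R).
Proof. by split=> [_|]; [exact: ler01 | rewrite (bigD1 tt) //= big1 ?addr0 // => -[]]. Qed.

Section Blocklength.
Variables (n : nat) (delta : R).
Hypotheses (n0 : (0 < n)%N) (del0 : 0 < delta) (del1 : delta < 1 / 64).
Implicit Types (x : {ffun 'I_n -> X}) (y : {ffun 'I_n -> Y}).

Let del : 0 <= delta < 1. Proof. by move: del0 del1 => ? ?; apply/andP; split; lra. Qed.
Let del6 : 0 <= 6 * delta < 1.
Proof. by move: del0 del1 => ? ?; apply/andP; split; lra. Qed.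

Local Notation zip x y := ([ffun i => (x i, y i)] : {ffun 'I_n -> X * Y}).
Definition sig x y := tensn (fun i => rho (x i) (y i)).
Definition sigX x := tensn (fun i => rhoX rho pY (x i)).
Definition sigY y := tensn (fun i => rhoY rho pX (y i)).
Definition sigB := tensn (fun _ : 'I_n => rhoB rho pX pY).
(** [prA] and [prB] project on [A'] and [B']; [prX] and [pr0] are the typical
    projectors of [rho_{x^n}] and [rho^n], the latter viewed as conditionally
    typical for a one-point alphabet. *)
Definition prA x y := tproj pw U2 lam2 delta delta (zip x y).
Definition prB y := condtyp_proj V mu (6 * delta) y.
Definition prX x := tproj pX VX nu delta delta x.
Definition pr0 := tproj (fun _ : unit => 1) (fun=> VB) (fun=> kap) delta delta [ffun _ : 'I_n => tt].
Definition dec x y := dec_proj pX pY U lam V mu delta (1 / 100) x y.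
Definition rt x y := tsqrt U2 lam2 (zip x y).

Lemma sig_zip x y : sig x y = tensn (fun i => rho2 (zip x y i)).
Proof. by apply: eq_tensn => i; rewrite ffunE. Qed.

Lemma rtK x y : rt x y *m mxH (rt x y) = sig x y.
Proof. by rewrite (tsqrtK lam_distr dU2) sig_zip. Qed.

Lemma hs_rt x y : hs (rt x y) = 1.
Proof.
rewrite -[rt x y]mul1mx hs_rtr2 mxH1 !mul1mx rtK sig_zip.
exact: (rtr_tens lam_distr dU2).
Qed.

Lemma isproj_prA x y : isproj (prA x y). Proof. exact: isproj_tproj dU2 _ _ _. Qed.
Lemma isproj_prB y : isproj (prB y). Proof. exact: isproj_condtyp dV _ _. Qed.
Lemma isproj_prX x : isproj (prX x). Proof. exact: isproj_tproj dVX _ _ _. Qed.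
Lemma isproj_pr0 : isproj pr0.
Proof. exact: isproj_tproj (fun _ : unit => dVB) _ _ _. Qed.

Lemma sqrt_eps : 1 - Num.sqrt (1 / 100) = 9 / 10 :> R.
Proof.
have -> : 1 / 100 = (1 / 10) ^+ 2 :> R by field.
by rewrite sqrtr_sqr ger0_norm; lra.
Qed.

Lemma decE x y : dec x y =
  if typical pw delta (zip x y) then tilted (prA x y) (prB y) (9 / 10) else 0.
Proof.
rewrite /dec /dec_proj /prA /tproj; case: ifP => _; last by [].
rewrite (orthproj_support (isproj_condtyp dU2 _ _)) (orthproj_support (isproj_condtyp dV _ _)).
by rewrite sqrt_eps.
Qed.

Lemma isproj_dec x y : isproj (dec x y).
Proof.
by rewrite decE; case: ifP => _; [exact: isproj_tilted | exact: isproj0].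
Qed.

Lemma dec_lop x y : lop (dec x y) (toC (10 / 9) *: (prB y *m prA x y *m prB y)).
Proof.
rewrite decE; case: ifP => [_|ty].
  have -> : 10 / 9 = (9 / 10)^-1 :> R by field.
  by apply: (lop_tilted (isproj_prA x y) (isproj_prB y)); lra.
by rewrite /prA /tproj ty mulmx0 mul0mx scaler0 => m S.
Qed.

(** The factor is [6 / (1 - 9/10)]. On atypical pairs the test never accepts, but [prA] vanishes
    there too, so its own loss already equals 1. *)
Lemma dec_loss x y : hs ((1%:M - dec x y) *m rt x y) <=
  60 * (hs ((1%:M - prA x y) *m rt x y) + hs ((1%:M - prB y) *m rt x y)).
Proof.
rewrite decE; case: ifP => [_|ty].
  have -> : 60 = 6 / (1 - 9 / 10) :> R by field.
  by apply: (hs_tiltedC (isproj_prA x y) (isproj_prB y)); lra.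
rewrite /prA /tproj ty subr0 mul1mx hs_rt.
by have := hs_ge0 ((1%:M - prB y) *m rt x y); move: (hs _) => a; lra.
Qed.

Local Notation expA := (expR ((1 + delta) * (1 + delta) * n%:R * H_XY)).
Local Notation expY := (expR (- ((1 - delta) * (1 - 6 * delta) * n%:R * H_Y))).
Local Notation expX := (expR (- ((1 - delta) * (1 - delta) * n%:R * H_X))).
Local Notation expB := (expR (- ((1 - delta) * (1 - delta) * n%:R * H_B))).

Lemma prA_lop x y : lop (prA x y) (toC expA *: sig x y).
Proof. by rewrite sig_zip; exact: (tproj_ge pw lam_distr n0 dU2 (zip x y) del del). Qed.

Lemma avg_ip (T : finType) (p : T -> R) (F : 'I_n -> T -> 'M[C]_d) m (Z : 'M[C]_(_, m)) :
  \sum_(w : {ffun 'I_n -> T}) \prod_i p (w i) * ip Z (tensn (fun i => F i (w i)) *m Z) =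
  ip Z (tensn (fun i => \sum_t toC (p t) *: F i t) *m Z).
Proof.
have e M : ip Z (M *m Z) = rtr ((Z *m mxH Z) *m M) by rewrite /ip [LHS]rtr_mulC -mulmxA [LHS]rtr_mulC.
by rewrite e -avg_rtr; apply: eq_bigr => w _; rewrite e.
Qed.

Lemma proj_sandwich_ip (P M : 'M[C]_(nsys n d)) m (T : 'M[C]_(_, m)) : isproj P ->
  ip (P *m T) (M *m (P *m T)) = ip T (P *m M *m P *m T).
Proof. by move=> pP; rewrite -!mulmxA [RHS]ip_adj pP.1. Qed.

(** Holds for every received state [T]: the averaging acts on the decoder only. *)
Lemma dec_wrong_x y m (T : 'M[C]_(_, m)) :
  \sum_(x : {ffun 'I_n -> X}) \prod_i pX (x i) * hs (dec x y *m T) <= 10 / 9 * expA * expY * hs T.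
Proof.
have c0 : 0 <= 10 / 9 :> R by lra.
have pn0 x : 0 <= \prod_i pX (x i) by apply: prodr_ge0 => i _; exact: hX.1.
have h1 x : hs (dec x y *m T) <= 10 / 9 * ip (prB y *m T) (prA x y *m (prB y *m T)).
  rewrite (hs_proj (isproj_dec x y)) (proj_sandwich_ip _ _ (isproj_prB y)).
  by apply: le_trans (dec_lop x y T) _; rewrite -scalemxAl ipZr.
(* Flatness of [prB y] is available only for typical [y]; otherwise [prA] vanishes for every [x] and
   the sum is zero. *)
case: (boolP (typical pY delta y)) => ty; last first.
  rewrite big1 => [|x _].
    by apply: mulr_ge0 (hs_ge0 _); do 2!apply: mulr_ge0 (expR_ge0 _).
  suff z : hs (dec x y *m T) = 0 by rewrite z mulr0.
  apply/eqP; rewrite eq_le hs_ge0 andbT; apply: le_trans (h1 x) _.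
  rewrite /prA /tproj; case: ifP => [h|_]; first by rewrite (typical_snd hX h) in ty.
  by rewrite mul0mx /ip mulmx0 /rtr mxtrace0 mulr0.
apply: le_trans (_ : \sum_(x : {ffun 'I_n -> X}) 10 / 9 * (expA * (\prod_i pX (x i) * ip (prB y *m T) (sig x y *m (prB y *m T)))) <= _).
  apply: ler_sum => x _; apply: le_trans (ler_wpM2l (pn0 x) (h1 x)) _.
  rewrite mulrCA ler_wpM2l // mulrCA ler_wpM2l //.
  by apply: le_trans (prA_lop x y _) _; rewrite -scalemxAl ipZr.
move: (10 / 9) c0 {h1} => c c0.
rewrite -!mulr_sumr -(mulrA c) -(mulrA c) -(mulrA expA) ler_wpM2l // ler_wpM2l ?expR_ge0 //.
have -> : \sum_(x : {ffun 'I_n -> X}) \prod_i pX (x i) * ip (prB y *m T) (sig x y *m (prB y *m T)) =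
    ip (prB y *m T) (sigY y *m (prB y *m T)) := avg_ip pX (fun i a => rho a (y i)) _.
rewrite (proj_sandwich_ip _ _ (isproj_prB y)).
(* For typical [y], [prB y] is [tproj] with tolerance [delta] for [y] and [6 * delta] for the
   eigenvalue sequence. *)
have := tproj_flat pY mu_distr n0 dV y del del6.
rewrite /tproj ty => /(_ _ T); move/le_trans; apply.
by rewrite -scalemxAl mul1mx ipZr.
Qed.

Lemma rtr_dec x y : rtr (dec x y) <= 10 / 9 * expA.
Proof.
have c0 : 0 <= 10 / 9 :> R by lra.
apply: le_trans (lop_rtr (dec_lop x y)) _; rewrite rtrZ ler_wpM2l //.
apply: le_trans (_ : rtr (prA x y) <= _).
  have [pA pB] := (isproj_prA x y, isproj_prB y).
  rewrite -mulmxA rtr_mulC -mulmxA pB.2 -{1}pA.2 -mulmxA rtr_mulC -(hs_proj_rtr pA).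
  apply: le_trans (hs_proj_le pB _); rewrite (hs_proj pB) /ip pA.1 mulmxA.
  by rewrite rtr_mulC mulmxA.
apply: le_trans (lop_rtr (prA_lop x y)) _.
by rewrite rtrZ sig_zip (rtr_tens lam_distr dU2) mulr1.
Qed.

(** The order matters: [prX] must touch the state first, to be used after averaging over [y] alone,
    and [pr0] last, to survive the average over both codewords. *)
Definition flat x y := pr0 *m (prX x *m rt x y).

Lemma flat_avg_y x (P : 'M[C]_(nsys n d)) : isproj P ->
  \sum_(y : {ffun 'I_n -> Y}) \prod_i pY (y i) * hs (P *m flat x y) =
  ip (pr0 *m P) (prX x *m sigX x *m prX x *m (pr0 *m P)).
Proof.
move=> pP; set M := P *m (pr0 *m prX x).
transitivity (\sum_(y : {ffun 'I_n -> Y}) \prod_i pY (y i) * rtr ((mxH M *m M) *m sig x y)).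
  by apply: eq_bigr => y _; rewrite -rtK -hs_rtr2 /M /flat !mulmxA.
have -> : \sum_(y : {ffun 'I_n -> Y}) \prod_i pY (y i) * rtr ((mxH M *m M) *m sig x y) =
    rtr ((mxH M *m M) *m sigX x) := avg_rtr pY (fun i b => rho (x i) b) _.
rewrite -mulmxA rtr_mulC /ip /M.
by rewrite !mxHM pP.1 isproj_pr0.1 (isproj_prX x).1 !mulmxA.
Qed.

Lemma hs_pr0_dec x y : hs (pr0 *m dec x y) <= 10 / 9 * expA.
Proof.
apply: le_trans (hs_proj_le isproj_pr0 _) _; rewrite (hs_proj_rtr (isproj_dec x y)).
exact: rtr_dec.
Qed.

Lemma dec_wrong_y x x' y' :
  \sum_(y : {ffun 'I_n -> Y}) \prod_i pY (y i) * hs (dec x' y' *m flat x y) <= 10 / 9 * expA * expX.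
Proof.
rewrite (flat_avg_y x (isproj_dec x' y')) mulrC.
apply: le_trans (tproj_flat pX nu_distr n0 dVX x del del _) _.
rewrite -scalemxAl mul1mx ipZr ler_wpM2l ?expR_ge0 //; exact: hs_pr0_dec.
Qed.

(** After the average over [y], [prX] is discarded because [prX sigX prX <= sigX]. The average over
    [x] then gives the i.i.d. state, which [pr0] flattens, and the trace of the test supplies
    [expA]. *)
Lemma dec_wrong_xy x' y' :
  \sum_(x : {ffun 'I_n -> X}) \prod_i pX (x i) * \sum_(y : {ffun 'I_n -> Y}) \prod_i pY (y i) * hs (dec x' y' *m flat x y) <=
  10 / 9 * expA * expB.
Proof.
have pn0 x : 0 <= \prod_i pX (x i) by apply: prodr_ge0 => i _; exact: hX.1.
apply: le_trans (_ : \sum_(x : {ffun 'I_n -> X}) \prod_i pX (x i) * ip (pr0 *m dec x' y') (sigX x *m (pr0 *m dec x' y')) <= _).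
  apply: ler_sum => x _; rewrite ler_wpM2l // (flat_avg_y x (isproj_dec x' y')).
  exact: (tproj_sandwich_le pX nu_distr dVX delta delta x).
have -> : \sum_(x : {ffun 'I_n -> X}) \prod_i pX (x i) * ip (pr0 *m dec x' y') (sigX x *m (pr0 *m dec x' y')) =
    ip (pr0 *m dec x' y') (sigB *m (pr0 *m dec x' y')) := avg_ip pX (fun i a => rhoX rho pY a) _.
rewrite (proj_sandwich_ip _ _ isproj_pr0) mulrC.
have := tproj_flat (fun _ : unit => 1) (fun=> kap_distr) n0 (fun _ : unit => dVB) [ffun _ : 'I_n => tt] del del.
rewrite cond_entropy_unit => /(_ _ (dec x' y'))/le_trans; apply.
rewrite -scalemxAl mul1mx ipZr ler_wpM2l ?expR_ge0 //.
rewrite -/(hs _) (hs_proj_rtr (isproj_dec x' y')); exact: rtr_dec.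
Qed.

(** The part of the error due to the transmitted pair alone; 480 is the 8 of [sequential_error]
    times the 60 of [dec_loss]. *)
Definition single_err tau x y :=
  tau + (tau^-1 + 12) * (hs ((1%:M - prX x) *m rt x y) + hs ((1%:M - pr0) *m rt x y))
  + 480 * (hs ((1%:M - prA x y) *m rt x y) + hs ((1%:M - prB y) *m rt x y)).

(** Only pairs preceding the sent one are tested before it. The sum is enlarged to all other pairs,
    which removes the dependence on the order of the loop. *)
Lemma err_msg_le (M1 M2 : nat) (c1 : codebook1 X n M1) (c2 : codebook2 Y n M2) m1 m2 tau :
  0 < tau ->
  err_msg rho pX pY U lam V mu delta (1 / 100) c1 c2 m1 m2 <=
  single_err tau (c1 m1) (c2 m2) +
  4 * \sum_(k | k != (m1, m2)) hs (dec (c1 k.1) (c2 k.2) *m flat (c1 m1) (c2 m2)).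
Proof.
move=> tau0; set s := take (index (m1, m2) (lexpairs M1 M2)) (lexpairs M1 M2).
have tr1 : rtr (sig (c1 m1) (c2 m2)) = 1 by rewrite sig_zip; exact: (rtr_tens lam_distr dU2).
apply: le_trans (@sequential_error_state R _ _ _ (fun k => dec (c1 k.1) (c2 k.2)) _ _ (rt (c1 m1) (c2 m2))
  (fun k => isproj_dec _ _) (isproj_prX (c1 m1)) isproj_pr0 _ _ s (m1, m2) tau (rtK _ _) tr1 tau0 erefl) _.
rewrite /single_err.
have hl := dec_loss (c1 m1) (c2 m2).
have hs_s : \sum_(k <- s) hs (dec (c1 k.1) (c2 k.2) *m flat (c1 m1) (c2 m2)) <=
    \sum_(k | k != (m1, m2)) hs (dec (c1 k.1) (c2 k.2) *m flat (c1 m1) (c2 m2)).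
  have ul : uniq (lexpairs M1 M2).
    by apply: allpairs_uniq; rewrite ?enum_uniq // => -[a b] [a' b'].
  have us : uniq s by apply: take_uniq.
  have ks : (m1, m2) \notin s.
    have kl : (m1, m2) \in lexpairs M1 M2.
      by apply/allpairsP; exists (m1, m2); rewrite !mem_enum.
    by rewrite /s in_take // ltnn.
  rewrite (big_uniq _ us) /= big_mkcond [leRHS]big_mkcond /=; apply: ler_sum => k _.
  case: (boolP (k \in s)) => [h|_]; last by case: ifP => // _; exact: hs_ge0.
  by have -> : k != (m1, m2) by apply: contra ks => /eqP <-.
apply: lerD; last by rewrite ler_pM2l ?ltr0n.
rewrite lerD2l (_ : 480 = 8 * 60); last by ring.
by rewrite -mulrA ler_pM2l ?ltr0n.
Qed.

End Blocklength.

(** Each loss is averaged over the codewords its projector does not see: [prX] over [y], [prB] over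
    [x], [pr0] over both. Every average becomes a classical atypicality probability. *)
Lemma single_err_lln delta tau : 0 < delta < 1 / 64 -> 0 < tau -> exists2 K : R, 0 <= K &
  forall n, (0 < n)%N ->
  \sum_(x : {ffun 'I_n -> X}) \sum_(y : {ffun 'I_n -> Y})
    \prod_i pX (x i) * \prod_i pY (y i) * single_err delta tau x y <= tau + K / n%:R.
Proof.
move=> /andP[del0 del1] tau0.
have dd : 0 < delta <= 1 by apply/andP; split; lra.
have dd6 : 0 < 6 * delta <= 1 by apply/andP; split; lra.
have [KA KA0 hA] := cond_lln dw lam_distr dd.
have [KB KB0 hB] := cond_lln hY mu_distr dd6.
have [KX KX0 hXX] := cond_lln hX nu_distr dd.
have [K0 K00 h0] := cond_lln d1 (fun _ : unit => kap_distr) dd.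
exists ((tau^-1 + 12) * (KX + K0) + 480 * (KA + KB)).
  have ti : 0 < tau^-1 by rewrite invr_gt0.
  have ti' : 0 <= tau^-1 + 12 by apply: addr_ge0 (ltW ti) _; rewrite ler0n.
  by apply: addr_ge0; apply: mulr_ge0; [exact: ti' | exact: addr_ge0 | rewrite ler0n | exact: addr_ge0].
move=> n n0.
have pX0 (x : {ffun 'I_n -> X}) : 0 <= \prod_i pX (x i) := (product_distr _ hX).1 x.
have pY0 (y : {ffun 'I_n -> Y}) : 0 <= \prod_i pY (y i) := (product_distr _ hY).1 y.
have sX : \sum_(x : {ffun 'I_n -> X}) \prod_i pX (x i) = 1 := (product_distr _ hX).2.
have sY : \sum_(y : {ffun 'I_n -> Y}) \prod_i pY (y i) = 1 := (product_distr _ hY).2.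
pose E (F : {ffun 'I_n -> X} -> {ffun 'I_n -> Y} -> R) :=
  \sum_(x : {ffun 'I_n -> X}) \prod_i pX (x i) * \sum_(y : {ffun 'I_n -> Y}) \prod_i pY (y i) * F x y.
have EE F : E F = \sum_(x : {ffun 'I_n -> X}) \sum_(y : {ffun 'I_n -> Y}) \prod_i pX (x i) * \prod_i pY (y i) * F x y.
  by apply: eq_bigr => x _; rewrite mulr_sumr; apply: eq_bigr => y _; rewrite mulrA.
have EC F : E F = \sum_(y : {ffun 'I_n -> Y}) \prod_i pY (y i) * \sum_(x : {ffun 'I_n -> X}) \prod_i pX (x i) * F x y.
  rewrite EE exchange_big; apply: eq_bigr => y _; rewrite mulr_sumr; apply: eq_bigr => x _.
  by rewrite mulrA [X in X * _ = _]mulrC.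
have avY x M : \sum_(y : {ffun 'I_n -> Y}) \prod_i pY (y i) * rtr (M *m sig x y) = rtr (M *m sigX x).
  exact: (avg_rtr pY (fun i b => rho (x i) b)).
have avX y M : \sum_(x : {ffun 'I_n -> X}) \prod_i pX (x i) * rtr (M *m sig x y) = rtr (M *m sigY y).
  exact: (avg_rtr pX (fun i a => rho a (y i))).
have hsr (Q : 'M[C]_(nsys n d)) x y : isproj Q -> hs ((1%:M - Q) *m rt x y) = rtr ((1%:M - Q) *m sig x y).
  by move=> pQ; rewrite (hs_rtr _ (isprojC pQ)) rtK.
have eX : E (fun x y => hs ((1%:M - prX delta x) *m rt x y)) <= KX / n%:R.
  apply: le_trans (hXX n n0); apply: ler_sum => x _; rewrite ler_wpM2l //.
  rewrite -(tproj_loss pX dVX delta delta x) -avY; apply: ler_sum => y _.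
  by rewrite (hsr _ _ _ (isproj_prX delta x)).
have e0 : E (fun x y => hs ((1%:M - pr0 n delta) *m rt x y)) <= K0 / n%:R.
  apply: le_trans (h0 n n0).
  (* Over the one-point alphabet only the constant sequence matters; any remaining terms are dropped
     as nonnegative. *)
  rewrite (bigD1 [ffun=> tt]) //= [X in X * _ + _]big1 // mul1r.
  apply: ler_wpDr.
    apply: sumr_ge0 => w _; apply: mulr_ge0; first by apply: prodr_ge0.
    apply: sumr_ge0 => s _; apply: mulr_ge0; last exact: ler0n.
    by apply: prodr_ge0 => i _; rewrite kap_distr.1.
  rewrite -(tproj_loss (fun=> 1) (fun _ : unit => dVB) delta delta [ffun=> tt]).
  rewrite -/(pr0 n delta) -/(sigB n).
  have -> : rtr ((1%:M - pr0 n delta) *m sigB n) =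
      \sum_(x : {ffun 'I_n -> X}) \prod_i pX (x i) * rtr ((1%:M - pr0 n delta) *m sigX x).
    exact: esym (avg_rtr pX (fun i a => rhoX rho pY a) _).
  apply: ler_sum => x _; rewrite ler_wpM2l // -avY; apply: ler_sum => y _.
  by rewrite (hsr _ _ _ (isproj_pr0 n delta)).
have eA : E (fun x y => hs ((1%:M - prA delta x y) *m rt x y)) <= KA / n%:R.
  apply: le_trans (hA n n0); rewrite big_zip EE; apply: ler_sum => x _; apply: ler_sum => y _.
  rewrite -(tproj_loss pw dU2) (hsr _ _ _ (isproj_prA delta x y)) -sig_zip -big_split /=.
  have -> : \prod_i pw ([ffun i => (x i, y i)] i) = \prod_(i < n) (pX (x i) * pY (y i)).
    by apply: eq_bigr => i _; rewrite ffunE.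
  exact: lexx.
have eB : E (fun x y => hs ((1%:M - prB delta y) *m rt x y)) <= KB / n%:R.
  apply: le_trans (hB n n0); rewrite EC; apply: ler_sum => y _; rewrite ler_wpM2l //.
  rewrite -(tproj_loss pY dV (6 * delta) (6 * delta) y).
  apply: le_trans (_ : rtr ((1%:M - prB delta y) *m sigY y) <= _).
    by rewrite -avX; apply: ler_sum => x _; rewrite (hsr _ _ _ (isproj_prB delta y)).
  (* [prB] is not cut off at atypical [y], whereas [tproj] is. There the right side is the full
     trace of the state, which dominates any loss. *)
  rewrite /tproj; case: ifP => _; first exact: lexx.
  have pC := isprojC (isproj_prB delta y).
  rewrite subr0 /sigY -(tsqrtK mu_distr dV y) -(hs_rtr _ pC).
  apply: le_trans (hs_proj_le pC _) _.
  by rewrite -{1}[tsqrt _ _ _]mul1mx hs_rtr2 mxH1 mul1mx.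
have ED F G : E (fun x y => F x y + G x y) = E F + E G.
  by rewrite !EE -big_split; apply: eq_bigr => x _; rewrite -big_split; apply: eq_bigr => y _; rewrite mulrDr.
have EZ c F : E (fun x y => c * F x y) = c * E F.
  by rewrite !EE mulr_sumr; apply: eq_bigr => x _; rewrite mulr_sumr; apply: eq_bigr => y _; rewrite mulrCA.
have E1 : E (fun _ _ => tau) = tau.
  rewrite /E; under eq_bigr do rewrite -mulr_suml sY mul1r.
  by rewrite -mulr_suml sX mul1r.
rewrite -(EE (single_err delta tau)) /single_err.
rewrite (ED (fun x y => tau + (tau^-1 + 12) * (hs ((1%:M - prX delta x) *m rt x y) + hs ((1%:M - pr0 n delta) *m rt x y)))).
rewrite (ED (fun _ _ => tau)) (EZ (tau^-1 + 12)) (EZ 480).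
rewrite (ED (fun x y => hs ((1%:M - prX delta x) *m rt x y))).
rewrite (ED (fun x y => hs ((1%:M - prA delta x y) *m rt x y))) E1.
have ti : 0 <= tau^-1 + 12 by rewrite addr_ge0 // invr_ge0 ltW.
rewrite -addrA lerD2l [leRHS]mulrDl; apply: lerD; rewrite -mulrA; apply: ler_wpM2l => //.
  by rewrite [leRHS]mulrDl lerD.
by rewrite [leRHS]mulrDl lerD.
Qed.

End MAC.

(** * Random codebooks *)

Section RandomCodebook.
Variables (R : realType) (T1 T2 : finType) (p1 : T1 -> R) (p2 : T2 -> R) (M1 M2 : nat).
Hypotheses (dp1 : distr p1) (dp2 : distr p2).
Local Notation cb1 := {ffun 'I_M1 -> T1}.
Local Notation cb2 := {ffun 'I_M2 -> T2}.

Lemma distr_avg_le (T : finType) (p : T -> R) F a : distr p -> (forall t, F t <= a) ->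
  \sum_t p t * F t <= a.
Proof.
move=> [p0 p1'] h; rewrite -[leRHS]mul1r -p1' mulr_suml.
by apply: ler_sum => t _; rewrite ler_wpM2l.
Qed.

Let EE (F : cb1 -> cb2 -> R) :=
  \sum_(c1 : cb1) \prod_m p1 (c1 m) * \sum_(c2 : cb2) \prod_m p2 (c2 m) * F c1 c2.

Let P1 (c : cb1) : 0 <= \prod_m p1 (c m). Proof. exact: (product_distr _ dp1).1. Qed.
Let P2 (c : cb2) : 0 <= \prod_m p2 (c m). Proof. exact: (product_distr _ dp2).1. Qed.

Let EE_le F G : (forall c1 c2, F c1 c2 <= G c1 c2) -> EE F <= EE G.
Proof.
by move=> h; apply: ler_sum => c1 _; rewrite ler_wpM2l //; apply: ler_sum => c2 _; rewrite ler_wpM2l.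
Qed.
Let EED F G : EE (fun c1 c2 => F c1 c2 + G c1 c2) = EE F + EE G.
Proof.
rewrite /EE -big_split /=; apply: eq_bigr => c1 _; rewrite -mulrDr -big_split /=; congr (_ * _).
by apply: eq_bigr => c2 _; rewrite mulrDr.
Qed.
Let EEZ a F : EE (fun c1 c2 => a * F c1 c2) = a * EE F.
Proof.
rewrite /EE mulr_sumr; apply: eq_bigr => c1 _; rewrite mulrCA; congr (_ * _).
by rewrite mulr_sumr; apply: eq_bigr => c2 _; rewrite mulrCA.
Qed.
Let EE_sum (I : finType) (P : pred I) F :
  EE (fun c1 c2 => \sum_(i | P i) F i c1 c2) = \sum_(i | P i) EE (F i).
Proof.
rewrite /EE exchange_big; apply: eq_bigr => c1 _; rewrite -mulr_sumr exchange_big; congr (_ * _).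
by apply: eq_bigr => c2 _; rewrite mulr_sumr.
Qed.

Variables (err : cb1 -> cb2 -> 'I_M1 -> 'I_M2 -> R)
  (E : T1 -> T2 -> R) (f : T1 -> T2 -> T1 -> T2 -> R) (e al be ga : R).
Hypotheses (errE : forall c1 c2 m1 m2, err c1 c2 m1 m2 <=
    E (c1 m1) (c2 m2) + 4 * \sum_(k | k != (m1, m2)) f (c1 m1) (c2 m2) (c1 k.1) (c2 k.2))
  (e0 : 0 <= e) (al0 : 0 <= al) (be0 : 0 <= be) (ga0 : 0 <= ga)
  (hE : \sum_x \sum_y p1 x * p2 y * E x y <= e)
  (hal : forall x y, \sum_x' p1 x' * f x y x' y <= al)
  (hbe : forall x y', \sum_y p2 y * f x y x y' <= be)
  (hga : forall x' y', \sum_x p1 x * \sum_y p2 y * f x y x' y' <= ga).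

Lemma EE_single m1 m2 : EE (fun c1 c2 => E (c1 m1) (c2 m2)) <= e.
Proof.
apply: le_trans hE; rewrite /EE.
under eq_bigr do rewrite (marginal1 dp2 m2 (E _)).
rewrite (marginal1 dp1 m1 (fun x => \sum_y p2 y * E x y)).
by apply: ler_sum => x _; rewrite mulr_sumr; apply: ler_sum => y _; rewrite mulrA.
Qed.

(** Equal indices share one random codeword, distinct indices are independent. A wrong first
    component alone is averaged over the wrong [x'], the other two patterns over the sent codewords.
    Keeping [ga] in every case overcounts but makes the sum over [k] immediate. *)
Lemma EE_pair m1 m2 k : k != (m1, m2) ->
  EE (fun c1 c2 => f (c1 m1) (c2 m2) (c1 k.1) (c2 k.2)) <=
  (k.2 == m2)%:R * al + (k.1 == m1)%:R * be + ga.
Proof.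
case: k => a b /=; rewrite xpair_eqE negb_and /EE.
have [-> |am] := eqVneq a m1; have [-> //|bm] := eqVneq b m2; move=> _.
- rewrite mul0r add0r mul1r.
  under eq_bigr do rewrite (marginal2 dp2 (fun y y' => f _ y _ y') (_ : m2 != b)) 1?eq_sym //.
  rewrite (marginal1 dp1 m1 (fun x => \sum_y \sum_y' p2 y * p2 y' * f x y x y')).
  apply: le_trans (_ : be <= _); last by rewrite lerDl.
  apply: distr_avg_le => // x; rewrite exchange_big /=.
  apply: le_trans (_ : \sum_y' p2 y' * \sum_y p2 y * f x y x y' <= _).
    apply: ler_sum => y' _; rewrite mulr_sumr; apply: ler_sum => y _.
    by rewrite mulrA [p2 y' * _]mulrC.
  exact: distr_avg_le.
- rewrite mul0r addr0 mul1r.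
  under eq_bigr do rewrite (marginal1 dp2 m2 (fun y => f _ y _ y)).
  rewrite (marginal2 dp1 (fun x x' => \sum_y p2 y * f x y x' y)) 1?eq_sym //.
  apply: le_trans (_ : al <= _); last by rewrite lerDl.
  apply: le_trans (_ : \sum_x p1 x * \sum_y p2 y * \sum_x' p1 x' * f x y x' y <= _).
    apply: ler_sum => x _; under eq_bigr do rewrite -mulrA; rewrite -mulr_sumr ler_wpM2l ?dp1.1 //.
    under eq_bigr do rewrite mulr_sumr; rewrite exchange_big /=.
    by apply: ler_sum => y _; rewrite mulr_sumr; apply: ler_sum => x' _; rewrite mulrCA.
  by apply: distr_avg_le => // x; apply: distr_avg_le.
- rewrite !mul0r !add0r.
  under eq_bigr do rewrite (marginal2 dp2 (fun y y' => f _ y _ y') (_ : m2 != b)) 1?eq_sym //.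
  rewrite (marginal2 dp1 (fun x x' => \sum_y \sum_y' p2 y * p2 y' * f x y x' y')) 1?eq_sym //.
  apply: le_trans (_ : \sum_x' p1 x' * \sum_y' p2 y' * \sum_x p1 x * \sum_y p2 y * f x y x' y' <= _); last first.
    by apply: distr_avg_le => // x'; apply: distr_avg_le.
  rewrite exchange_big /=; apply: ler_sum => x' _.
  apply: le_trans (_ : p1 x' * \sum_x p1 x * \sum_y \sum_y' p2 y * p2 y' * f x y x' y' <= _).
    by rewrite mulr_sumr; apply: ler_sum => x _; rewrite mulrA [p1 x' * _]mulrC.
  rewrite ler_wpM2l ?dp1.1 //.
  under [leRHS]eq_bigr do rewrite mulr_sumr; rewrite [leRHS]exchange_big /=.
  apply: ler_sum => x _; under [leRHS]eq_bigr do rewrite mulrCA; rewrite -mulr_sumr.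
  rewrite ler_wpM2l ?dp1.1 // exchange_big /=; apply: ler_sum => y' _.
  by rewrite mulr_sumr; apply: ler_sum => y _; rewrite mulrA [p2 y' * _]mulrC.
Qed.

Lemma EE_err m1 m2 : EE (fun c1 c2 => err c1 c2 m1 m2) <=
  e + 4 * (M1%:R * al + M2%:R * be + (M1 * M2)%:R * ga).
Proof.
apply: le_trans (EE_le (fun c1 c2 => errE c1 c2 m1 m2)) _.
rewrite (EED (fun c1 c2 => E (c1 m1) (c2 m2))) lerD ?EE_single // EEZ ler_pM2l ?ltr0n //.
rewrite (EE_sum (fun k => k != (m1, m2)) (fun k c1 c2 => f (c1 m1) (c2 m2) (c1 k.1) (c2 k.2))).
apply: le_trans (_ : \sum_(k : 'I_M1 * 'I_M2) ((k.2 == m2)%:R * al + (k.1 == m1)%:R * be + ga) <= _).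
  rewrite big_mkcond; apply: ler_sum => k _; case: ifP => h; first exact: EE_pair.
  by rewrite !addr_ge0 // mulr_ge0.
rewrite !big_split /= sumr_const card_prod !card_ord -[ga *+ _]mulr_natl.
rewrite -!mulr_suml; have s (M : nat) (m : 'I_M) : \sum_(i < M) (i == m)%:R = 1 :> R.
  by rewrite (bigD1 m) //= eqxx big1 ?addr0 // => i /negPf ->.
have -> : \sum_(k : 'I_M1 * 'I_M2) (k.2 == m2)%:R = M1%:R :> R.
  rewrite -(pair_bigA _ (fun (_ : 'I_M1) (j : 'I_M2) => (j == m2)%:R)) /=.
  by under eq_bigr do rewrite s; rewrite sumr_const card_ord.
have -> : \sum_(k : 'I_M1 * 'I_M2) (k.1 == m1)%:R = M2%:R :> R.
  rewrite -(pair_bigA _ (fun (i : 'I_M1) (_ : 'I_M2) => (i == m1)%:R)) /= exchange_big /=.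
  by under eq_bigr do rewrite s; rewrite sumr_const card_ord.
exact: lexx.
Qed.

Lemma expected_codebook :
  \sum_(c1 : cb1) \sum_(c2 : cb2) \prod_m p1 (c1 m) * \prod_m p2 (c2 m) *
     ((M1 * M2)%:R^-1 * \sum_m1 \sum_m2 err c1 c2 m1 m2) <=
  e + 4 * (M1%:R * al + M2%:R * be + (M1 * M2)%:R * ga).
Proof.
set B := e + _.
have B0 : 0 <= B by rewrite addr_ge0 // mulr_ge0 // !addr_ge0 // mulr_ge0.
apply: le_trans (_ : (M1 * M2)%:R^-1 * \sum_m1 \sum_m2 EE (fun c1 c2 => err c1 c2 m1 m2) <= _).
  apply: le_trans (_ : EE (fun c1 c2 => (M1 * M2)%:R^-1 * \sum_m1 \sum_m2 err c1 c2 m1 m2) <= _).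
    apply: ler_sum => c1 _; rewrite mulr_sumr; apply: ler_sum => c2 _; by rewrite -mulrA.
  rewrite EEZ ler_wpM2l ?invr_ge0 ?ler0n //.
  rewrite (EE_sum predT (fun m1 c1 c2 => \sum_m2 err c1 c2 m1 m2)); apply: ler_sum => m1 _.
  by rewrite (EE_sum predT (fun m2 c1 c2 => err c1 c2 m1 m2)).
apply: le_trans (_ : (M1 * M2)%:R^-1 * ((M1 * M2)%:R * B) <= _).
  rewrite ler_wpM2l ?invr_ge0 ?ler0n //.
  apply: le_trans (_ : \sum_(m1 < M1) \sum_(m2 < M2) B <= _).
    by apply: ler_sum => m1 _; apply: ler_sum => m2 _; exact: EE_err.
  by rewrite !sumr_const !card_ord -mulrnA mulnC mulr_natl.
(* A negative rate can make a message set empty; the claim is then [0 <= B]. *)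
have [->|h] := eqVneq (M1 * M2)%N 0%N; first by rewrite mul0r mulr0.
by rewrite mulKf // pnatr_eq0.
Qed.

End RandomCodebook.

(** * Rates *)

Section Rates.
Variable R : realType.

Lemma nat_entropy_ge0 d (q : 'I_d -> R) : distr q -> 0 <= nat_entropy q.
Proof.
move=> dq; apply: sumr_ge0 => b _; rewrite -mulrN mulr_ge0 ?dq.1 // oppr_ge0.
by apply: ln_le0; exact: distr_le1.
Qed.

Lemma cond_entropy_ge0 (W : finType) d (p : W -> R) (q : W -> 'I_d -> R) :
  distr p -> (forall a, distr (q a)) -> 0 <= cond_entropy p q.
Proof. by move=> dp dq; apply: sumr_ge0 => a _; rewrite mulr_ge0 ?dp.1 ?nat_entropy_ge0. Qed.

Lemma ln2_gt0 : 0 < ln 2 :> R.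
Proof. by rewrite ln_gt0 // ltr1n. Qed.

Lemma nmsg_le n (r : R) : (nmsg n r)%:R <= expR (n%:R * (r * ln 2)).
Proof.
rewrite /nmsg; apply: le_trans (_ : 2 `^ (n%:R * r) <= _).
  by rewrite truncn_le powR_ge0.
by rewrite /powR pnatr_eq0 /= mulrA.
Qed.

Lemma expRN_le (x : R) : 0 < x -> expR (- x) <= x^-1.
Proof.
move=> x0; rewrite expRN lef_pV2 ?posrE ?expR_gt0 //.
by apply: le_trans (expR_ge1Dx x); rewrite lerDr.
Qed.

(** For [delta <= 1] the tolerances cost at most [3 * delta * HA] and, as [k <= 6], at most
    [7 * delta * HZ]. Both fit under [7 * delta * (HA + HZ)], which the factor 14 makes at most half
    of the gap [g]. *)
Lemma rate_exponent (HA HZ delta k g r : R) : 0 <= HA -> 0 <= HZ -> 0 <= delta <= 1 ->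
  0 <= k <= 6 -> 14 * (delta * (HA + HZ)) <= g -> r <= HZ - HA - g ->
  r + (1 + delta) * (1 + delta) * HA - (1 - delta) * (1 - k * delta) * HZ <= - (g / 2).
Proof.
move=> a0 z0 /andP[d0 d1] /andP[k0 k6] hg hr.
have e1 : delta * delta * HA <= delta * HA by rewrite -mulrA ler_piMl // mulr_ge0.
have e2 : 0 <= k * (delta * delta * HZ) by rewrite !mulr_ge0.
have e3 : k * (delta * HZ) <= 6 * (delta * HZ) by rewrite ler_wpM2r // mulr_ge0.
have e4 : 0 <= delta * HA by rewrite mulr_ge0.
have -> : r + (1 + delta) * (1 + delta) * HA - (1 - delta) * (1 - k * delta) * HZ =
  r + HA + 2 * (delta * HA) + delta * delta * HA - HZ + delta * HZ + k * (delta * HZ) - k * (delta * delta * HZ) by ring.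
have e5 : delta * (HA + HZ) = delta * HA + delta * HZ by ring.
rewrite {}e5 in hg.
move: e1 e2 e3 e4 hg; move: (delta * delta * HA) (k * (delta * delta * HZ)) (k * (delta * HZ)) (delta * HA) (delta * HZ) => *; lra.
Qed.

(** The exponential decay is deliberately weakened to [1 / n], so that one choice of [n] also covers
    the law of large numbers. The constant 4 rounds up [10/9 * 2]. *)
Lemma wrong_message_decay (n : nat) (M r HA HZ delta k g : R) : (0 < n)%N -> 0 < g ->
  0 <= HA -> 0 <= HZ -> 0 <= delta <= 1 ->
  0 <= k <= 6 -> 14 * (delta * (HA + HZ)) <= g -> r <= HZ - HA - g ->
  M <= expR (n%:R * r) ->
  M * (10 / 9 * expR ((1 + delta) * (1 + delta) * n%:R * HA) *
    expR (- ((1 - delta) * (1 - k * delta) * n%:R * HZ))) <= 4 / g / n%:R.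
Proof.
move=> n0 g0 a0 z0 hd hk hg hr hM.
have n0' : 0 < n%:R :> R by rewrite ltr0n.
set A := expR _; set Z := expR (- _).
have A0 : 0 <= A by exact: expR_ge0.
have Z0 : 0 <= Z by exact: expR_ge0.
apply: le_trans (_ : expR (n%:R * r) * (10 / 9 * A * Z) <= _).
  by rewrite ler_wpM2r // !mulr_ge0 // ?invr_ge0 ler0n.
have -> : expR (n%:R * r) * (10 / 9 * A * Z) = 10 / 9 * (expR (n%:R * r) * A * Z) by ring.
rewrite /A /Z -!expRD.
apply: le_trans (_ : 10 / 9 * expR (- (n%:R * (g / 2))) <= _).
  rewrite ler_wpM2l ?divr_ge0 ?ler0n // ler_expR.
  have -> : n%:R * r + (1 + delta) * (1 + delta) * n%:R * HA +
      - ((1 - delta) * (1 - k * delta) * n%:R * HZ) =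
    n%:R * (r + (1 + delta) * (1 + delta) * HA - (1 - delta) * (1 - k * delta) * HZ) by ring.
  by rewrite -[leRHS]mulrN ler_pM2l //; exact: rate_exponent.
have gn : 0 < n%:R * (g / 2) by rewrite mulr_gt0 // divr_gt0 // ltr0n.
apply: le_trans (ler_wpM2l _ (expRN_le gn)) _; first by rewrite divr_ge0 ?ler0n.
have -> : 10 / 9 * (n%:R * (g / 2))^-1 = 20 / 9 * (g^-1 / n%:R) by field; rewrite !gt_eqF.
have q : 0 <= g^-1 / n%:R by apply: divr_ge0; [rewrite invr_ge0 ltW | exact: ltW].
by rewrite -[leRHS]mulrA ler_wpM2r //; lra.
Qed.

End Rates.

(** * Choice of the tolerance and of the block length *)

Theorem theorem2 (R : realType) (X Y : finType) (d : nat)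
  (rho : X -> Y -> 'M[R[i]]_d) (pX : X -> R) (pY : Y -> R)
  (U : X -> Y -> 'M[R[i]]_d) (lam : X -> Y -> 'I_d -> R)
  (V : Y -> 'M[R[i]]_d) (mu : Y -> 'I_d -> R) :
  (forall x y, density (rho x y)) ->
  distr pX -> distr pY ->
  (forall x y, eigdec (rho x y) (U x y) (lam x y)) ->
  (forall y, eigdec (rhoY rho pX y) (V y) (mu y)) ->
  forall R1 R2 : R,
  R1 < I_X_B_given_Y rho pX pY ->
  R2 < I_Y_B_given_X rho pX pY ->
  R1 + R2 < I_XY_B rho pX pY ->
  forall eta : R, 0 < eta ->
  exists (delta eps : R) (n : nat),
    [/\ 0 < delta < 1 / 64, 0 < eps < 1 / 64, (0 < n)%N &
      expected_avg_err rho pX pY U lam V mu n (nmsg n R1) (nmsg n R2) delta eps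
        <= eta].
Proof.
move=> hrho hX hY dU dV R1 R2 h1 h2 h3 eta eta0.
(* The statement fixes eigenbases only for $\rho_{xy}$ and $\rho_y$. Those of $\rho_x$ and of the
   average state serve the analysis alone, so any choice will do. *)
have hq x : exists W q, eigdec (rhoX rho pY x) W q.
  by apply: herm_eigdec; exact: esym (rhoX_density hrho hY x).1.1.
have [VX hVX] := fin_all_exists hq.
have [nu dVX] := fin_all_exists hVX.
have [VB [kap dVB]] := herm_eigdec (esym (rhoB_density hrho hX hY).1.1).
set HA := cond_entropy (pXY pX pY) (fun w => lam w.1 w.2).
set HY := cond_entropy pY mu; set HX := cond_entropy pX nu; set HB := nat_entropy kap.
have l2 := ln2_gt0 R.
have {}h1 : R1 * ln 2 < HY - HA.
  by move: h1; rewrite (I_X_B_given_Y_eq hrho hX hY dU dV) ltr_pdivlMr.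
have {}h2 : R2 * ln 2 < HX - HA.
  by move: h2; rewrite (I_Y_B_given_X_eq hrho hX hY dU dVX) ltr_pdivlMr.
have {}h3 : (R1 + R2) * ln 2 < HB - HA.
  by move: h3; rewrite (I_XY_B_eq hrho hX hY dU dVB) ltr_pdivlMr.
have HA0 : 0 <= HA.
  apply: cond_entropy_ge0 => [|w]; last exact: density_distr (hrho _ _) (dU _ _).
  exact: pXY_distr.
have HY0 : 0 <= HY.
  by apply: cond_entropy_ge0 => // y; exact: density_distr (rhoY_density hrho hX y) (dV y).
have HX0 : 0 <= HX.
  by apply: cond_entropy_ge0 => // x; exact: density_distr (rhoX_density hrho hY x) (dVX x).
have HB0 : 0 <= HB by apply: nat_entropy_ge0; exact: density_distr (rhoB_density hrho hX hY) dVB.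
have [g g0 [g1 g2 g3]] : exists2 g : R, 0 < g &
    [/\ R1 * ln 2 <= HY - HA - g, R2 * ln 2 <= HX - HA - g & (R1 + R2) * ln 2 <= HB - HA - g].
  exists (Num.min (HY - HA - R1 * ln 2) (Num.min (HX - HA - R2 * ln 2) (HB - HA - (R1 + R2) * ln 2))).
    by rewrite !lt_min !subr_gt0 h1 h2 h3.
  split; rewrite lerBrDr addrC -lerBrDr !ge_min ?lexx ?orbT //.
(* [S] dominates each sum [HA + HZ], and the added 1 keeps it positive, so [delta <= g / (14 * S)]
   meets the requirement of [rate_exponent] for all three error types at once. *)
pose S := HA + HY + HX + HB + 1.
have S0 : 0 < S by rewrite ltr_pwDr // !addr_ge0.
pose delta := Num.min (1 / 128) (g / (14 * S)).
have del0 : 0 < delta.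
  by rewrite lt_min !divr_gt0 // ?ltr0n // mulr_gt0 // ltr0n.
have del128 : delta <= 1 / 128 by rewrite ge_min lexx.
have delS : 14 * (delta * S) <= g.
  rewrite mulrCA -ler_pdivlMr ?mulr_gt0 ?ltr0n //; by rewrite ge_min lexx orbT.
have del1 : delta < 1 / 64 by lra.
have hd : 0 <= delta <= 1 by apply/andP; split; lra.
have gH HZ : 0 <= HZ -> HA + HZ <= S -> 14 * (delta * (HA + HZ)) <= g.
  move=> z0 hz; apply: le_trans delS; rewrite ler_pM2l ?ltr0n // ler_pM2l //.
have tau0 : 0 < eta / 2 by rewrite divr_gt0 // ltr0n.
have del01 : 0 < delta < 1 / 64 by rewrite del0 del1.
have [K K0 hK] := single_err_lln hrho hX hY dU dV dVX dVB del01 tau0.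
(* Three kinds of wrong pairs contribute [4 / g] each, multiplied by the 4 of the union bound. Half
   of [eta] is spent on [tau], the other half on [K' / n]. *)
pose K' := K + 4 * (3 * (4 / g)).
pose n := (Num.trunc (K' / (eta / 2))).+1.
have n0 : (0 < n)%N by [].
have n0' : 0 < n%:R :> R by rewrite ltr0n.
exists delta, (1 / 100), n; split=> //; first by apply/andP; split; lra.
have hn : K' / n%:R <= eta / 2.
  rewrite ler_pdivrMr // mulrC -ler_pdivrMr //; apply: ltW; exact: truncnS_gt.
set A := expR ((1 + delta) * (1 + delta) * n%:R * HA).
(* The factors [6 * delta] and [1 * delta] match [wrong_message_decay] with [k] equal to 6 or 1; the
   6 is the wider tolerance of [prB]. *)
pose al := 10 / 9 * A * expR (- ((1 - delta) * (1 - 6 * delta) * n%:R * HY)).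
pose be := 10 / 9 * A * expR (- ((1 - delta) * (1 - 1 * delta) * n%:R * HX)).
pose ga := 10 / 9 * A * expR (- ((1 - delta) * (1 - 1 * delta) * n%:R * HB)).
have c0 : 0 <= 10 / 9 * A by rewrite mulr_ge0 ?expR_ge0 // divr_ge0 ?ler0n.
have al0 : 0 <= al by rewrite mulr_ge0 ?expR_ge0.
have be0 : 0 <= be by rewrite mulr_ge0 ?expR_ge0.
have ga0 : 0 <= ga by rewrite mulr_ge0 ?expR_ge0.
have ntau : 0 <= eta / 2 + K / n%:R.
  by apply: addr_ge0; [exact: ltW | apply: divr_ge0; [exact: K0 | exact: ltW]].
(* The bound of [dec_wrong_x] is proportional to the squared norm of the state, which compression by
   projectors does not increase. *)
have flat1 (x : {ffun 'I_n -> X}) (y : {ffun 'I_n -> Y}) :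
    hs (flat pX U lam VX nu VB kap delta x y) <= 1.
  rewrite -(hs_rt hrho dU x y) /flat.
  apply: le_trans (hs_proj_le (isproj_pr0 dVB n delta) _) _.
  exact: hs_proj_le (isproj_prX pX dVX delta x) _.
apply: le_trans (@expected_codebook R _ _ (fun x : {ffun 'I_n -> X} => \prod_i pX (x i))
  (fun y : {ffun 'I_n -> Y} => \prod_i pY (y i)) (nmsg n R1) (nmsg n R2)
  (product_distr _ hX) (product_distr _ hY) (err_msg rho pX pY U lam V mu delta (1 / 100))
  (single_err pX pY U lam V mu VX nu VB kap delta (eta / 2))
  (fun x y x' y' => hs (dec pX pY U lam V mu delta x' y' *m flat pX U lam VX nu VB kap delta x y))
  (eta / 2 + K / n%:R) al be ga
  (fun c1 c2 m1 m2 => err_msg_le hrho dU dV dVX dVB delta c1 c2 m1 m2 tau0)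
  ntau al0 be0 ga0 (hK n n0) _ _ _) _.
- move=> x y; apply: le_trans (dec_wrong_x pY hrho hX dU dV n0 del0 del1 y _) _.
  by rewrite -[leRHS]mulr1 ler_wpM2l.
- move=> x y'; rewrite /be mul1r; exact: (dec_wrong_y hrho hY dU dV dVX dVB n0 del0 del1).
- move=> x' y'; rewrite /ga mul1r; exact: (dec_wrong_xy hrho hX hY dU dV dVX dVB n0 del0 del1).
have k6 : (0 : R) <= 6 <= (6 : R) by rewrite ler0n lexx.
have k1 : (0 : R) <= 1 <= (6 : R) by rewrite ler01 ler1n.
have m1 : (nmsg n R1)%:R * al <= 4 / g / n%:R.
  by apply: (wrong_message_decay n0 g0 HA0 HY0 hd k6 _ g1 (nmsg_le n R1)); apply: gH => //; rewrite /S; lra.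
have m2 : (nmsg n R2)%:R * be <= 4 / g / n%:R.
  by apply: (wrong_message_decay n0 g0 HA0 HX0 hd k1 _ g2 (nmsg_le n R2)); apply: gH => //; rewrite /S; lra.
have m3 : (nmsg n R1 * nmsg n R2)%:R * ga <= 4 / g / n%:R.
  apply: (wrong_message_decay n0 g0 HA0 HB0 hd k1 _ g3); first by apply: gH => //; rewrite /S; lra.
  by rewrite natrM mulrDl mulrDr expRD ler_pM ?nmsg_le.
apply: le_trans (_ : eta / 2 + K / n%:R + 4 * (4 / g / n%:R + 4 / g / n%:R + 4 / g / n%:R) <= _).
  by rewrite lerD2l ler_pM2l ?ltr0n // !lerD.
have -> : eta / 2 + K / n%:R + 4 * (4 / g / n%:R + 4 / g / n%:R + 4 / g / n%:R) = eta / 2 + K' / n%:R.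
  by rewrite /K'; ring.
by rewrite [leRHS](splitr eta) lerD2l.
Qed.
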